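(* Let $M$ be an infinite-horizon discounted-reward MDP with MNL transitions and discount factor $\gamma\in[0,1)$, satisfying (A1)–(A3). Let $\delta\in(0,1)$, $\eta=\frac12\log\mathcal{U}+(L_\theta L_\varphi+1)$, $\lambda\ge84\sqrt2(L_\theta L_\varphi^3+dL_\varphi^2)\eta$, and $N\ge\log(\sqrt T/d)/(1-\gamma)$. Then the (non-stationary) policy $\pi$ of \texttt{UCMNLK} run with discount $\gamma$ guarantees, with probability at least $1-2\delta$, $\mathrm{Regret}(\pi,T)=\tilde{\mathcal O}\big(f(L_\theta,L_\varphi)(d(1-\gamma)^{-2}\sqrt T+\kappa^{-1}d^2(1-\gamma)^{-2})\big)$, where $f$ is a polynomial in $(L_\theta,L_\varphi)$ and $\tilde{\mathcal O}$ hides logarithmic factors of $T,\mathcal U,1/\delta$.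
   Context: MDP: finite $\mathcal{S},\mathcal{A}$, known reward $r:\mathcal{S}\times\mathcal{A}\to[0,1]$; known reachable sets $\mathcal{S}_{s,a}$ and features $\varphi(s,a,s')\in\mathbb{R}^d$; transitions $p(s'\mid s,a,\theta^* )$ with $p(s'\mid s,a,\theta)=\exp(\varphi(s,a,s')^\top\theta)/\sum_{s''\in\mathcal{S}_{s,a}}\exp(\varphi(s,a,s'')^\top\theta)$ on $\mathcal{S}_{s,a}$; $\mathcal U=\max|\mathcal{S}_{s,a}|$. For a history-dependent policy $\pi$, $V^\pi_t(s)=\mathbb{E}[\sum_{i\ge0}\gamma^ir(s_{t+i},a_{t+i})\mid s_t=s]$ (given the history); $V^*(s)=\max_\pi V^\pi_1(s)$; $\mathrm{Regret}(\pi,T)=\sum_{t=1}^TV^*(s_t)-\sum_{t=1}^TV^\pi_t(s_t)$. Assumptions: (A1) $\|\varphi\|_2\le L_\varphi$, $\|\theta^*\|_2\le L_\theta$, $\Theta=\{\|\theta\|_2\le L_\theta\}$; (A2) $\kappa\in(0,1)$ with $\inf_{\theta\in\Theta}p(s'\mid s_t,a_t,\theta)p(s''\mid s_t,a_t,\theta)\ge\kappa$ for all $t\in[T]$, $s',s''\in\mathcal{S}_{s_t,a_t}$; (A3) each $\mathcal{S}_{s,a}$ contains $s'$ with $\varphi(s,a,s')=0$. Estimator, confidence polytopes $\mathcal{P}_t$ (with radii $\beta_t=f_0(L_\theta,L_\varphi)\sqrt d(\log(\mathcal Ut/\delta))^2$, $f_0$ a fixed polynomial for which $\|\widehat\theta_t-\theta^*\|_{\Sigma_t}\le\beta_t$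 for all $t$ w.p. $\ge1-\delta$), \texttt{DEVI} and \texttt{UCMNLK}: exactly as follows. $\ell_t(\theta)=-\sum_{s'\in\mathcal{S}_{s_t,a_t}}\mathbf1\{s_{t+1}=s'\}\log p(s'\mid s_t,a_t,\theta)$; $\widehat\theta_1=0$, $\Sigma_1=\lambda I_d$, $\widehat\Sigma_t=\Sigma_t+\eta\nabla^2\ell_t(\widehat\theta_t)$, $\widehat\theta_{t+1}=\arg\min_{\theta\in\Theta}\{\nabla\ell_t(\widehat\theta_t)^\top(\theta-\widehat\theta_t)+\frac1{2\eta}\|\theta-\widehat\theta_t\|^2_{\widehat\Sigma_t}\}$, $\Sigma_{t+1}=\Sigma_t+\nabla^2\ell_t(\widehat\theta_{t+1})$. $\mathcal P_t$: all $p\in[0,1]^{\mathcal S\times\mathcal A\times\mathcal S}$ with $\sum_{s'\in\mathcal S_{s,a}}p_{s,a,s'}=1$ and $\sum_{s'\in\mathcal S_{s,a}}|p_{s,a,s'}-p(s'\mid s,a,\widehat\theta_t)|\le\beta_t\sum_{s'}p(s'\mid s,a,\widehat\theta_t)\|\varphi(s,a,s')-\sum_{s''}p(s''\mid s,a,\widehat\theta_t)\varphi(s,a,s'')\|_{\Sigma_t^{-1}}+3\beta_t^2\max_{s'}\|\varphi(s,a,s')\|^2_{\Sigma_t^{-1}}$ for all $(s,a)$. \texttt{DEVI}$(\gamma,\mathcal P,N)$: $Q^{(0)}\equiv1/(1-\gamma)$, $V^{(n-1)}(s)=\max_aQ^{(n-1)}(s,a)$, $Q^{(n)}(s,a)=r(s,a)+\gamma\max_{p\in\mathcal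 P}\sum_{s'\in\mathcal S_{s,a}}p_{s,a,s'}V^{(n-1)}(s')$ for $n=1..N$, return $Q^{(N)}$. \texttt{UCMNLK}: for episodes $k$: $t_k=t$, $Q_k=\texttt{DEVI}(\gamma,\mathcal P_{t_k},N)$, $\pi_k(s)\in\arg\max_aQ_k(s,a)$; while $\det\Sigma_t\le2\det\Sigma_{t_k}$, play $a_t=\pi_k(s_t)$, observe $s_{t+1}$, update, $t\leftarrow t+1$. *)

(* Defs.v *)
From HB Require Import structures.
From mathcomp Require Import all_boot all_order all_algebra.
From mathcomp Require Import all_classical all_reals all_analysis.
Set Implicit Arguments. Unset Strict Implicit. Unset Printing Implicit Defensive.
Import Order.TTheory GRing.Theory Num.Theory.
Import numFieldNormedType.Exports.
Local Open Scope classical_set_scope.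
Local Open Scope ring_scope.

Section MNLMDP.
Variables (R : realType) (S A : finType) (d : nat).
Variables (Ssa : S -> A -> {set S}) (phi : S -> A -> S -> 'cV[R]_d).

Definition dotv (x y : 'cV[R]_d) : R := (x^T *m y) 0 0.
Definition norm2 (x : 'cV[R]_d) : R := Num.sqrt (dotv x x).
Definition wnorm (M : 'M[R]_d) (x : 'cV[R]_d) : R := Num.sqrt ((x^T *m M *m x) 0 0).

Definition Ucal : nat := \max_(sa : S * A) #|Ssa sa.1 sa.2|.

Definition pmnl (theta : 'cV[R]_d) (s : S) (a : A) (s' : S) : R :=
  if s' \in Ssa s a then
    expR (dotv (phi s a s') theta) /
      \sum_(s'' in Ssa s a) expR (dotv (phi s a s'') theta)
  else 0.

Definition loss (s : S) (a : A) (snext : S) (theta : 'cV[R]_d) : R :=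
  - \sum_(s' in Ssa s a) (snext == s')%:R * ln (pmnl theta s a s').

Definition evec (i : 'I_d) : 'cV[R]_d := delta_mx i 0.
Definition grad (f : 'cV[R]_d -> R) (theta : 'cV[R]_d) : 'cV[R]_d :=
  \col_i ('D_(evec i) f theta).
Definition hess (f : 'cV[R]_d -> R) (theta : 'cV[R]_d) : 'M[R]_d :=
  \matrix_(i, j) ('D_(evec j) (fun th => 'D_(evec i) f th) theta).

Variables (r : S -> A -> R) (gamma lambda eta delta Ltheta Lphi : R) (N : nat).
Variable f0 : R -> R -> R.
Variable argsel : (A -> R) -> A.   (* an argmax selector: any tie-breaking rule *)
Variable a0 : A.

Definition Theta : set 'cV[R]_d := [set th | norm2 th <= Ltheta].

Definition beta (t : nat) : R :=
  f0 Ltheta Lphi * Num.sqrt d%:R * (ln ((Ucal * t)%:R / delta)) ^+ 2.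

Definition polytope (th : 'cV[R]_d) (Sg : 'M[R]_d) (t : nat)
    (p : S -> A -> S -> R) : Prop :=
  (forall s a s', 0 <= p s a s' <= 1) /\
  forall s a,
    \sum_(s' in Ssa s a) p s a s' = 1 /\
    \sum_(s' in Ssa s a) `|p s a s' - pmnl th s a s'| <=
      beta t * \sum_(s' in Ssa s a) pmnl th s a s' *
         wnorm (invmx Sg) (phi s a s' - \sum_(s'' in Ssa s a) pmnl th s a s'' *: phi s a s'')
      + 3 * beta t ^+ 2 *
         \big[Num.max/0]_(s' in Ssa s a) (wnorm (invmx Sg) (phi s a s')) ^+ 2.

Definition amax (f : A -> R) : R := \big[Num.max/f a0]_(a : A) f a.

Fixpoint devi_iter (P : (S -> A -> S -> R) -> Prop) (n : nat) : S -> A -> R :=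
  match n with
  | 0 => fun _ _ => (1 - gamma)^-1
  | n'.+1 => let V := fun s => amax (devi_iter P n' s) in
      fun s a => r s a + gamma * sup [set x | exists p, P p /\
                     x = \sum_(s' in Ssa s a) p s a s' * V s']
  end.
Definition DEVI (P : (S -> A -> S -> R) -> Prop) : S -> A -> R := devi_iter P N.

Record astate := AState {
  th_hat : 'cV[R]_d;
  Sigma : 'M[R]_d;
  time : nat;
  det_k : R;           (* det Sigma_{t_k} of the current episode *)
  pi_k : S -> A
}.

Definition episode_policy (th : 'cV[R]_d) (Sg : 'M[R]_d) (t : nat) : S -> A :=
  fun s => argsel (DEVI (polytope th Sg t) s).

Definition init_state : astate :=
  AState 0 (lambda%:M) 1 (\det (lambda%:M : 'M[R]_d))
         (episode_policy 0 (lambda%:M) 1).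

Definition step (st : astate) (s s' : S) : astate :=
  let a := pi_k st s in
  let l := loss s a s' in
  let Sghat := Sigma st + eta *: hess l (th_hat st) in
  let obj := fun th => dotv (grad l (th_hat st)) (th - th_hat st)
              + (2 * eta)^-1 * (wnorm Sghat (th - th_hat st)) ^+ 2 in
  let th' := xget 0 [set th | Theta th /\ forall th2, Theta th2 -> obj th <= obj th2] in
  let Sg' := Sigma st + hess l th' in
  let t' := (time st).+1 in
  if \det Sg' <= 2 * det_k st then AState th' Sg' t' (det_k st) (pi_k st)
  else AState th' Sg' t' (\det Sg') (episode_policy th' Sg' t').

Fixpoint run (st : astate) (s : S) (rest : seq S) : astate :=
  match rest with
  | [::] => st
  | s' :: rest' => run (step st s s') s' rest'
  end.

Definition alg_state (s1 : S) (rest : seq S) : astate := run init_state s1 rest.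

Definition ucmnlk (s1 : S) (rest : seq S) : A :=
  pi_k (alg_state s1 rest) (last s1 rest).

Variable theta_star : 'cV[R]_d.

(* a deterministic history-dependent policy: history s1 :: rest -> action *)
Definition hpolicy := S -> seq S -> A.

Fixpoint Vfin (pol : hpolicy) (H : nat) (s1 : S) (rest : seq S) : R :=
  match H with
  | 0 => 0
  | H'.+1 => let s := last s1 rest in let a := pol s1 rest in
      r s a + gamma * \sum_(s' : S) pmnl theta_star s a s' * Vfin pol H' s1 (rcons rest s')
  end.

(* V^pi_t(s_t) given the history s1 :: rest (t = size rest + 1) *)
Definition Vpi (pol : hpolicy) (s1 : S) (rest : seq S) : R :=
  limn (fun H => Vfin pol H s1 rest).

Definition Vstar (s : S) : R := sup [set x | exists pol : hpolicy, x = Vpi pol s [::]].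

(* Regret(pi, T) on the trajectory s1 :: rest, with size rest = T - 1 *)
Definition regret (pol : hpolicy) (T : nat) (s1 : S) (rest : seq S) : R :=
  \sum_(i < T) (Vstar (last s1 (take i rest)) - Vpi pol s1 (take i rest)).

Fixpoint prob (pol : hpolicy) (n : nat) (s1 : S) (rest : seq S) (E : seq S -> Prop) : R :=
  match n with
  | 0 => if `[< E rest >] then 1 else 0
  | n'.+1 => \sum_(s' : S) pmnl theta_star (last s1 rest) (pol s1 rest) s' *
               prob pol n' s1 (rcons rest s') E
  end.

Fixpoint feasible_from (pol : hpolicy) (s1 : S) (pre rest : seq S) : Prop :=
  match rest with
  | [::] => True
  | s' :: rest' => s' \in Ssa (last s1 pre) (pol s1 pre) /\
                   feasible_from pol s1 (rcons pre s') rest'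
  end.
Definition feasible pol s1 rest := feasible_from pol s1 [::] rest.

End MNLMDP.

Definition bipoly (R : realType) (n : nat) (c : 'I_n -> 'I_n -> R) (x y : R) : R :=
  \sum_(i < n) \sum_(j < n) c i j * x ^+ i * y ^+ j.

(* Main.v *)
Require Import Defs.
From HB Require Import structures.
From mathcomp Require Import all_boot all_order all_algebra.
From mathcomp Require Import all_classical all_reals all_analysis.
From mathcomp Require Import perm ring lra.
Import Order.TTheory GRing.Theory Num.Theory.
Import numFieldNormedType.Exports.
Local Open Scope classical_set_scope.
Local Open Scope ring_scope.
Set Implicit Arguments. Unset Strict Implicit. Unset Printing Implicit Defensive.

(** Write [x_t] for the trace of [Sigma_t^-1 H_t], where [H_t] is the Hessian of
    the loss at the updated estimate; the determinant inequality
    [det (Sigma_t + H_t) >= det Sigma_t * (1 + x_t)] telescopes to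
    [sum x_t = O(d log T)] and also bounds the number of episodes.  Since the
    confidence event places both the estimate used for planning and the updated
    estimate within [beta] of [theta_star], the mean feature deviation that enters
    the confidence radius can be evaluated at the updated estimate up to a
    second-order error, so the radius at time [t] is at most a constant times
    [beta * sqrt x_t + beta^2 * x_t / kappa]: only the second-order term pays for
    [kappa].  The optimistic values dominate the values of all policies, and
    unfolding the Bellman equation of the history-dependent policy along the
    trajectory reduces the regret to these radii, the number of episodes, the
    truncation error [gamma^N] and a bounded martingale, which an exponential
    moment bound controls.  When [sqrt T <= d] the bound is trivial; otherwise
    [log d <= log T]. *)

(** The obstacle is a double mismatch: planning uses the estimate and the matrix of the start of the
    episode, while information is gained at the updated estimate. The stopping rule repairs the
    matrix: as long as the determinant at most doubles, inverse quadratic forms change by at most a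
    factor 2, because the quadratic form of the adjugate can only grow under rank-one updates. The
    mismatch of estimates costs a total variation distance linear in [beta] times a feature norm; it
    multiplies a second feature norm, so its effect is quadratic. Squared feature norms are not
    variances, and this is where [kappa] enters: by (A3) some outcome has feature 0, so the mean
    feature cannot be close to both it and another feature, and (A2) gives the pair the weight
    [kappa]. One factor [(1 - gamma)^-1] is the size of the values; the other appears because the
    gap at time t+1 returns, discounted, in the bound for the gap at time t. One [delta] pays for
    the confidence event and one for the martingale tail. If [Lphi = 0], then [lambda = 0] is
    admissible and the matrices are singular; this case is treated apart. *)

(** * Elementary bounds on exponential and logarithm *)

Section ExpBounds.
Variable R : realType.
Implicit Types (u v x : R).

Lemma expR_le_inv1B v : v < 1 -> expR v <= (1 - v)^-1.
Proof.
move=> v1; have h := expR_ge1Dx (- v).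
rewrite expRN in h.
have v0 : 0 < 1 - v by lra.
rewrite -[leLHS]invrK lef_pV2 ?posrE ?invr_gt0 ?expR_gt0 //; lra.
Qed.

(** Square the bound at [u / 2]: the condition on [l] compares it with the coefficient of [u ^+ 2]
    that remains after [1 + u]. *)
Lemma expR_half_quad (k l u : R) : 0 <= k -> expR (u / 2) <= 1 + u / 2 + k * (u / 2) ^+ 2 ->
  (2 * k + 1) / 4 + k * u / 4 + k ^+ 2 * u ^+ 2 / 16 <= l ->
  expR u <= 1 + u + l * u ^+ 2.
Proof.
move=> k0 h hl.
have -> : expR u = expR (u / 2) ^+ 2 by rewrite expr2 -expRD; congr expR; lra.
have := @lerXn2r R 2 _ _ (ltW (expR_gt0 (u/2))) (le_trans (ltW (expR_gt0 (u/2))) h) h.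
move=> /le_trans; apply.
have : 0 <= u ^+ 2 * (l - ((2 * k + 1) / 4 + k * u / 4 + k ^+ 2 * u ^+ 2 / 16)).
  by rewrite mulr_ge0 ?sqr_ge0 // subr_ge0.
by move=> h2; rewrite -subr_ge0; apply: le_trans h2 _; rewrite le_eqVlt; apply/orP; left; apply/eqP; field.
Qed.

(* Three halvings reach [|u| <= 1/8], where [expR u <= (1 - u)^-1] is sharp enough. *)
Lemma expR_le_quad u : `|u| <= 1 -> expR u <= 1 + u + u ^+ 2.
Proof.
rewrite ler_norml => /andP[u0 u1].
rewrite -[u ^+ 2]mul1r.
(* The quadratic coefficients at [u/2], [u/4] and [u/8] are 9/10, 1 and 8/7; the last is
   [1 / (1 - 1/8)], from [1/(1 - v) = 1 + v + v^2/(1 - v)]. *)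
apply: (@expR_half_quad (9/10)); [lra| |nra].
apply: (@expR_half_quad 1); [lra| |nra].
apply: (@expR_half_quad (8/7)); [lra| |nra].
apply: le_trans (expR_le_inv1B _) _; first lra.
rewrite -div1r ler_pdivrMr; last lra.
set v := u / 2 / 2 / 2.
have v1 : v <= 1/8 by rewrite /v; lra.
have : 0 <= v ^+ 2 * (1/7 - 8/7 * v) by rewrite mulr_ge0 ?sqr_ge0 //; lra.
by nra.
Qed.

(** The range is twice 33/40, a number just above the square root of 2/3: it covers the centred
    exponents in the nontrivial case of [tilt_tv]. *)
Lemma expR_le_quad_wide u : `|u| <= 33/20 -> expR u <= 1 + u + 3/2 * u ^+ 2.
Proof.
rewrite ler_norml => /andP[u0 u1].
apply: (@expR_half_quad 1); [lra| |nra].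
rewrite mul1r; apply: expR_le_quad; rewrite ler_norml; lra.
Qed.

(** Turns a determinant factor [1 + x] into the summand [x / 2] of a telescoping sum of logarithms.
    The restriction to [x <= 1] is met because the regularisation dominates the squared feature
    deviations. *)
Lemma ln_ge_half x : 0 <= x <= 1 -> x / 2 <= ln (1 + x).
Proof.
move=> /andP[x0 x1].
rewrite -ler_expR lnK ?posrE; last lra.
apply: le_trans (expR_le_inv1B _) _; first lra.
rewrite -div1r ler_pdivrMr; last lra.
nra.
Qed.

Lemma ln2_ge_half : 1/2 <= ln (2 : R).
Proof. by have := @ln_ge_half 1; rewrite ler01 lexx => /(_ isT); rewrite (_ : 1 + 1 = 2 :> R). Qed.

End ExpBounds.

(** * Quadratic forms and rank-one updates *)

Section QuadraticForms.
Variables (R : realType) (d : nat).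
Implicit Types (M A B : 'M[R]_d) (x y w : 'cV[R]_d).

Definition bil M x y : R := (x^T *m M *m y) 0 0.

Lemma bilDl M x x' y : bil M (x + x') y = bil M x y + bil M x' y.
Proof. by rewrite /bil linearD /= !mulmxDl mxE. Qed.
Lemma bilDr M x y y' : bil M x (y + y') = bil M x y + bil M x y'.
Proof. by rewrite /bil mulmxDr mxE. Qed.
Lemma bilZl M a x y : bil M (a *: x) y = a * bil M x y.
Proof. by rewrite /bil linearZ /= -!scalemxAl mxE. Qed.
Lemma bilZr M a x y : bil M x (a *: y) = a * bil M x y.
Proof. by rewrite /bil -scalemxAr mxE. Qed.
Lemma bilDm A B x y : bil (A + B) x y = bil A x y + bil B x y.
Proof. by rewrite /bil mulmxDr mulmxDl mxE. Qed.
Lemma bil_sym M x y : M^T = M -> bil M x y = bil M y x.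
Proof.
move=> sM; rewrite /bil; have -> : x^T *m M *m y = (y^T *m M *m x)^T.
  by rewrite !trmx_mul trmxK sM mulmxA.
by rewrite mxE.
Qed.
Lemma bil0l M y : bil M 0 y = 0.
Proof. by rewrite -(scale0r 0) bilZl mul0r. Qed.
Lemma bil_outer w x y : bil (w *m w^T) x y = dotv x w * dotv w y.
Proof.
rewrite /bil /dotv.
have -> : x^T *m (w *m w^T) *m y = (x^T *m w) *m (w^T *m y) by rewrite !mulmxA.
by rewrite mxE big_ord1.
Qed.

Lemma dotv_bil x y : dotv x y = bil 1%:M x y.
Proof. by rewrite /dotv /bil mulmx1. Qed.
Lemma dotvC x y : dotv x y = dotv y x.
Proof. by rewrite !dotv_bil bil_sym // trmx1. Qed.

Lemma dotv_ge0 x : 0 <= dotv x x.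
Proof.
rewrite /dotv mxE; apply: sumr_ge0 => i _; rewrite mxE -expr2; exact: sqr_ge0.
Qed.

Definition psd M := M^T = M /\ forall x, 0 <= bil M x x.

Lemma psd_cauchy M x y : psd M -> bil M x y ^+ 2 <= bil M x x * bil M y y.
Proof.
move=> [sM pM].
have h (t : R) : 0 <= bil M x x + 2 * t * bil M x y + t ^+ 2 * bil M y y.
  have := pM (x + t *: y); rewrite !(bilDl, bilDr, bilZl, bilZr) (bil_sym y x sM).
  by move=> h; nra.
have [y0|yn0] := eqVneq (bil M y y) 0.
  rewrite y0 mulr0; have [->|xyn0] := eqVneq (bil M x y) 0; first by rewrite expr0n.
  (* When [bil M y y] vanishes, the form is affine in [t], and this [t] would give it the value
     -1. *)
  have := h (- (bil M x x + 1) / (2 * bil M x y)).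
  rewrite y0 mulr0 addr0.
  have -> : 2 * (- (bil M x x + 1) / (2 * bil M x y)) * bil M x y = - (bil M x x + 1) by field.
  lra.
have yp : 0 < bil M y y by rewrite lt_neqAle eq_sym yn0 pM.
have := h (- bil M x y / bil M y y).
have -> : bil M x x + 2 * (- bil M x y / bil M y y) * bil M x y + (- bil M x y / bil M y y) ^+ 2 * bil M y y
  = (bil M x x * bil M y y - bil M x y ^+ 2) / bil M y y by field.
by rewrite pmulr_lge0 ?invr_gt0 // subr_ge0.
Qed.

Definition qf M x : R := bil M x x.
Lemma wnormE M x : wnorm M x = Num.sqrt (qf M x). Proof. by []. Qed.

Lemma wnorm_ge0 M x : 0 <= wnorm M x. Proof. exact: sqrtr_ge0. Qed.
Lemma wnorm_sqr M x : psd M -> wnorm M x ^+ 2 = qf M x.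
Proof. by move=> [_ p]; rewrite wnormE sqr_sqrtr // p. Qed.

Lemma abs_le_mul_sqrt (a b c : R) : 0 <= a -> 0 <= b -> c ^+ 2 <= a * b -> `|c| <= Num.sqrt a * Num.sqrt b.
Proof.
by move=> a0 b0 h; rewrite -sqrtrM // -sqrtr_sqr ler_sqrt // mulr_ge0.
Qed.

Lemma wnorm_cauchy M x y : psd M -> `|bil M x y| <= wnorm M x * wnorm M y.
Proof. by move=> pM; apply: abs_le_mul_sqrt; [exact: pM.2|exact: pM.2|exact: psd_cauchy]. Qed.

Lemma wnormD M x y : psd M -> wnorm M (x + y) <= wnorm M x + wnorm M y.
Proof.
move=> pM; rewrite -(@ler_pXn2r _ 2) ?nnegrE ?addr_ge0 ?wnorm_ge0 //.
rewrite wnorm_sqr // /qf !(bilDl, bilDr) (bil_sym y x pM.1).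
have := wnorm_cauchy x y pM; rewrite ler_norml => /andP[_ h].
have hx := wnorm_sqr x pM; have hy := wnorm_sqr y pM.
rewrite /qf in hx hy; nra.
Qed.

Lemma wnormZ M a x : wnorm M (a *: x) = `|a| * wnorm M x.
Proof.
rewrite !wnormE /qf bilZl bilZr mulrA -expr2 sqrtrM ?sqr_ge0 //.
by rewrite sqrtr_sqr.
Qed.
Lemma wnormN M x : wnorm M (- x) = wnorm M x.
Proof. by rewrite -scaleN1r wnormZ normrN1 mul1r. Qed.
Lemma wnorm0 M : wnorm M 0 = 0.
Proof. by rewrite wnormE /qf bil0l sqrtr0. Qed.
Lemma wnormB M x y : psd M -> wnorm M (x - y) <= wnorm M x + wnorm M y.
Proof. by move=> pM; apply: le_trans (wnormD _ _ pM) _; rewrite wnormN. Qed.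
Lemma wnorm_sum M (I : finType) (P : pred I) (F : I -> 'cV[R]_d) :
  psd M -> wnorm M (\sum_(i | P i) F i) <= \sum_(i | P i) wnorm M (F i).
Proof.
move=> pM; elim/big_ind2: _ => //; first by rewrite wnorm0.
by move=> a b c e h h'; apply: le_trans (wnormD _ _ pM) _; exact: lerD.
Qed.

Lemma norm2E x : norm2 x = wnorm 1%:M x.
Proof. by rewrite /norm2 wnormE /qf dotv_bil. Qed.
Lemma psd1 : psd (1%:M : 'M[R]_d).
Proof. by split; [rewrite trmx1|move=> x; rewrite -dotv_bil dotv_ge0]. Qed.

(* Positive definiteness in the form [psd] plus a positive determinant,
   which spares any appeal to eigenvalues. *)
Definition pdm M := psd M /\ 0 < \det M.

Lemma pdm_unit M : pdm M -> M \in unitmx.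
Proof. by move=> [_ h]; rewrite unitmxE unitfE gt_eqF. Qed.

Lemma bil_invmx M x y : M \in unitmx -> M^T = M -> bil (invmx M) x y = bil M (invmx M *m x) (invmx M *m y).
Proof.
move=> uM sM; rewrite /bil trmx_mul trmx_inv sM.
by rewrite -!mulmxA (mulmxA (invmx M) M) mulVmx // mul1mx.
Qed.

Lemma psd_invmx M : pdm M -> psd (invmx M).
Proof.
move=> pM; split; first by rewrite trmx_inv pM.1.1.
by move=> x; rewrite bil_invmx ?pdm_unit //; [exact: pM.1.2|exact: pM.1.1].
Qed.

(** Duality of the norms of [M] and its inverse: [dotv x y] is [bil M (invmx M *m x) y], so
    Cauchy-Schwarz for [M] applies. This converts confidence in parameter space into bounds on
    logits. *)
Lemma dotv_wnorm M x y : pdm M -> `|dotv x y| <= wnorm (invmx M) x * wnorm M y.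
Proof.
move=> pM; have uM := pdm_unit pM.
have -> : dotv x y = bil M (invmx M *m x) y.
  by rewrite /dotv /bil trmx_mul trmx_inv pM.1.1 -!mulmxA (mulmxA (invmx M)) mulVmx // mul1mx.
have -> : wnorm (invmx M) x = wnorm M (invmx M *m x).
  by rewrite !wnormE /qf bil_invmx ?pM.1.1.
exact: wnorm_cauchy pM.1.
Qed.

End QuadraticForms.

(** * Determinants and inverses under rank-one updates *)

Section RankOne.
Variables (R : realType) (d : nat).
Implicit Types (M A B C : 'M[R]_d) (x y w : 'cV[R]_d) (ws : seq 'cV[R]_d).

(** Matrix determinant lemma: the bordered matrix [B] is factored through the Schur complement of
    each of its diagonal blocks, and the two determinants are compared. *)
Lemma det_rank1 A w : A \in unitmx ->
  \det (A + w *m w^T) = \det A * (1 + qf (invmx A) w).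
Proof.
move=> uA; pose B : 'M[R]_(d + 1) := block_mx A w (- (w^T)) 1%:M.
have e1 : B = block_mx 1%:M 0 (- (w^T *m invmx A)) 1%:M *m
             block_mx A w 0 (1%:M + w^T *m invmx A *m w).
  rewrite mulmx_block !mul1mx !mul0mx !addr0 !mulNmx.
  by rewrite -!mulmxA mulVmx // mulmx1 mulmxA addrCA addNr addr0.
have e2 : B = block_mx 1%:M w 0 1%:M *m block_mx (A + w *m w^T) 0 (- (w^T)) 1%:M.
  by rewrite mulmx_block !mul1mx !mul0mx !mulmx1 !mulmxN !add0r addrK.
have h1 : \det B = \det A * (1 + qf (invmx A) w).
  rewrite e1 det_mulmx det_lblock det_ublock !det1 !mul1r; congr (_ * _).
  by rewrite det_mx11 mxE; congr (_ + _); rewrite mxE.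
by rewrite -h1 e2 det_mulmx det_ublock det_lblock !det1 !mulr1 mul1r.
Qed.

Lemma bil_rank1 A w x : qf (A + w *m w^T) x = qf A x + dotv x w ^+ 2.
Proof. by rewrite /qf bilDm bil_outer (dotvC w x) expr2. Qed.

Lemma pdm_rank1 A w : pdm A -> pdm (A + w *m w^T).
Proof.
move=> pA; have [[sA qA] dA] := pA; split; last first.
  rewrite det_rank1 ?pdm_unit // mulr_gt0 //.
  by rewrite ltr_pwDl // (psd_invmx pA).2.
split; first by rewrite linearD /= trmx_mul trmxK sA.
move=> x; have := bil_rank1 A w x; rewrite /qf => ->.
by rewrite addr_ge0 ?sqr_ge0.
Qed.

(** The Sherman-Morrison formula, read as a quadratic form. It is checked by showing that the
    candidate [z] solves [B *m z = x]. *)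
Lemma qf_inv_rank1 A w x : pdm A ->
  qf (invmx (A + w *m w^T)) x =
  qf (invmx A) x - bil (invmx A) x w ^+ 2 / (1 + qf (invmx A) w).
Proof.
move=> pA; set B := A + w *m w^T.
have uA := pdm_unit pA; have uB : B \in unitmx by exact/pdm_unit/pdm_rank1.
have pI := psd_invmx pA.
have a0 : 0 < 1 + qf (invmx A) w by rewrite ltr_pwDl // pI.2.
set a := qf (invmx A) w in a0 *.
set c := bil (invmx A) x w.
pose z := invmx A *m x - (c / (1 + a)) *: (invmx A *m w).
have eB : B *m z = x.
  rewrite /z /B mulmxDl !mulmxBr -!scalemxAr !(mulmxA A) mulmxV // !mul1mx.
  have E y : w *m w^T *m (invmx A *m y) = bil (invmx A) y w *: w.
    rewrite -mulmxA [w^T *m _]mulmxA.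
    rewrite [w^T *m _ *m y](mx11_scalar) mul_mx_scalar.
    by rewrite -[(_ *m _) 0 0]/(bil _ w y) (bil_sym w y pI.1).
  rewrite !E -/c -[bil _ w w]/a scalerA -addrA -[RHS]addr0; congr (_ + _).
  rewrite -scaleNr -scalerBl -scalerDl; apply/eqP; rewrite scaler_eq0; apply/orP; left.
  by apply/eqP; field; rewrite gt_eqF.
have -> : qf (invmx B) x = (x^T *m z) 0 0.
  by rewrite /qf /bil -{2}eB -mulmxA mulKmx.
rewrite /z mulmxBr -scalemxAr !mulmxA [LHS]mxE [X in _ + X]mxE [X in - X]mxE.
rewrite -![(_ *m _) 0 0]/(bil _ x _) -/c /qf; field.
by rewrite gt_eqF.
Qed.

(** Positive semidefinite updates are represented by a list of vectors, so that comparisons in the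
    Loewner order become inductions on rank-one updates. *)
Definition addouter A ws := A + \sum_(w <- ws) w *m w^T.

Lemma addouter_rcons A ws w : addouter A (rcons ws w) = addouter A ws + w *m w^T.
Proof. by rewrite /addouter -cats1 big_cat big_seq1 addrA. Qed.
Lemma addouter_cat A ws ws' : addouter (addouter A ws) ws' = addouter A (ws ++ ws').
Proof. by rewrite /addouter big_cat addrA. Qed.

Lemma addouter0 A : addouter A [::] = A.
Proof. by rewrite /addouter big_nil addr0. Qed.

Lemma pdm_addouter A ws : pdm A -> pdm (addouter A ws).
Proof.
move=> pA; elim/last_ind: ws => [|ws w IH]; first by rewrite addouter0.
by rewrite addouter_rcons; exact: pdm_rank1.
Qed.

Lemma qf_inv_addouter A ws x : pdm A ->
  qf (invmx (addouter A ws)) x <= qf (invmx A) x.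
Proof.
move=> pA; elim/last_ind: ws => [|ws w IH]; first by rewrite addouter0.
rewrite addouter_rcons qf_inv_rank1; last exact: pdm_addouter.
apply: le_trans IH; rewrite gerBl divr_ge0 ?sqr_ge0 // addr_ge0 //.
exact: (psd_invmx (pdm_addouter ws pA)).2.
Qed.

(* The adjugate is monotone: [det A * qf (invmx A) x] is the quadratic form of [adj A]. *)
Lemma adj_qf_addouter A ws x : pdm A ->
  \det A * qf (invmx A) x <= \det (addouter A ws) * qf (invmx (addouter A ws)) x.
Proof.
move=> pA; elim/last_ind: ws => [|ws w IH]; first by rewrite addouter0.
rewrite addouter_rcons; set B := addouter A ws in IH *.
have pB : pdm B by exact: pdm_addouter.
apply: le_trans IH _; rewrite qf_inv_rank1 // det_rank1 ?pdm_unit //.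
have pI := psd_invmx pB.
have a0 : 0 < 1 + qf (invmx B) w by rewrite ltr_pwDl // pI.2.
rewrite -mulrA ler_pM2l; last exact: pB.2.
rewrite mulrBr [in X in _ - X]mulrC divfK ?gt_eqF //.
(* The determinant factor [1 + qf (invmx B) w] cancels the Sherman-Morrison denominator; what
   remains is Cauchy-Schwarz for [invmx B]. *)
have := psd_cauchy x w pI; rewrite -/(qf _ x) -/(qf _ w); nra.
Qed.

(** Adding [w] to the current matrix [B] raises the determinant by [\det B * qf (invmx B) w], the
    adjugate form at [w]. By its monotonicity this is at least the value at [A], so the increments
    add up. *)
Lemma det_addouter A ws : pdm A ->
  \det A * (1 + \sum_(w <- ws) qf (invmx A) w) <= \det (addouter A ws).
Proof.
move=> pA; elim/last_ind: ws => [|ws w IH]; first by rewrite addouter0 big_nil addr0 mulr1.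
rewrite addouter_rcons det_rank1; last by apply/pdm_unit/pdm_addouter.
rewrite -cats1 big_cat big_seq1 addrA mulrDr [leRHS]mulrDr mulr1.
by apply: lerD => //; exact: adj_qf_addouter.
Qed.

Lemma det_addouter_le A ws : pdm A -> \det A <= \det (addouter A ws).
Proof.
move=> pA; apply: le_trans (det_addouter ws pA); rewrite ler_peMr ?(ltW pA.2) //.
by rewrite lerDl sumr_ge0 // => w _; exact: (psd_invmx pA).2.
Qed.

Lemma qf_addouter A ws x : qf A x <= qf (addouter A ws) x.
Proof.
elim/last_ind: ws => [|ws w IH]; first by rewrite addouter0.
by rewrite addouter_rcons bil_rank1; apply: le_trans IH _; rewrite lerDl sqr_ge0.
Qed.

Lemma wnorm_addouter A ws x : wnorm A x <= wnorm (addouter A ws) x.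
Proof. by rewrite !wnormE ler_wsqrtr // qf_addouter. Qed.

(** Monotonicity of the adjugate bounds the ratio of inverse forms by the ratio of determinants.
    This is why the episode rule tests a determinant. *)
Lemma qf_inv_doubling A ws x : pdm A -> \det (addouter A ws) <= 2 * \det A ->
  qf (invmx A) x <= 2 * qf (invmx (addouter A ws)) x.
Proof.
move=> pA h; rewrite -(ler_pM2l pA.2).
apply: le_trans (adj_qf_addouter ws x pA) _.
rewrite mulrA [X in _ <= X * _]mulrC; apply: ler_wpM2r => //.
exact: (psd_invmx (pdm_addouter ws pA)).2.
Qed.

Lemma pdm_scalar (l : R) : 0 < l -> pdm (l%:M : 'M[R]_d).
Proof.
move=> l0; split; last by rewrite det_scalar exprn_gt0.
split; first by rewrite tr_scalar_mx.
by move=> x; rewrite /bil mul_mx_scalar -scalemxAl mxE mulr_ge0 ?(ltW l0) // dotv_ge0.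
Qed.

Lemma qf_inv_scalar (l : R) x : qf (invmx (l%:M)) x = l^-1 * dotv x x.
Proof. by rewrite invmx_scalar /qf /bil mul_mx_scalar -scalemxAl mxE. Qed.

(** The Leibniz formula with absolute values. The factorial is affordable because only the logarithm
    of the determinant is used later. *)
Lemma norm_det_le M (b : R) : (forall i j, `|M i j| <= b) -> `|\det M| <= d`!%:R * b ^+ d.
Proof.
move=> h; rewrite /determinant; apply: le_trans (ler_norm_sum _ _ _) _.
apply: (@le_trans _ _ (\sum_(s : perm_of 'I_d) b ^+ d)).
  apply: ler_sum => s _; rewrite normrM normrX normrN1 expr1n mul1r normr_prod.
  rewrite -[X in b ^+ X]card_ord -prodr_const; apply: ler_prod => i _.
  by rewrite normr_ge0 h.
by rewrite sumr_const card_Sn mulr_natl.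
Qed.

End RankOne.

(** * Multinomial logit transitions *)

Section Tilt.
Variables (R : realType) (I : finType) (D : {set I}) (p q x : I -> R) (m : R).
Hypothesis p0 : forall i, i \in D -> 0 <= p i.
Hypothesis p1 : \sum_(i in D) p i = 1.
Hypothesis qE : forall i, i \in D -> q i = p i * expR (x i) / \sum_(j in D) p j * expR (x j).
Hypothesis xm : forall i, i \in D -> `|x i| <= m.

Let xbar := \sum_(i in D) p i * x i.
Let y i := x i - xbar.
Let Z := \sum_(i in D) p i * expR (y i).

Let Ey : \sum_(i in D) p i * y i = 0.
Proof.
under eq_bigr => i _ do rewrite mulrBr.
by rewrite sumrB -mulr_suml p1 mul1r subrr.
Qed.

Let Z1 : 1 <= Z.
Proof.
have <- : \sum_(i in D) p i * (1 + y i) = 1.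
  under eq_bigr => i _ do rewrite mulrDr mulr1.
  by rewrite big_split /= p1 Ey addr0.
by apply: ler_sum => i iD; rewrite ler_wpM2l ?p0 // expR_ge1Dx.
Qed.

Let qE' i : i \in D -> q i = p i * expR (y i) / Z.
Proof.
move=> iD; rewrite qE //.
have eZ : \sum_(j in D) p j * expR (x j) = expR xbar * Z.
  by rewrite mulr_sumr; apply: eq_bigr => j _; rewrite mulrCA -expRD /y addrC subrK.
rewrite eZ; have -> : expR (x i) = expR xbar * expR (y i).
  by rewrite -expRD /y addrC subrK.
by rewrite mulrCA -mulf_div divff ?mul1r // gt_eqF ?expR_gt0.
Qed.

Lemma tilt_ge0 i : i \in D -> 0 <= q i.
Proof.
move=> iD; rewrite qE' // divr_ge0 ?mulr_ge0 ?p0 ?expR_ge0 //.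
exact: le_trans ler01 Z1.
Qed.

Lemma tilt_sum1 : \sum_(i in D) q i = 1.
Proof.
rewrite (eq_bigr _ qE') -mulr_suml -/Z mulfV // gt_eqF //.
exact: lt_le_trans ltr01 Z1.
Qed.

Lemma xbar_le : `|xbar| <= m.
Proof.
apply: le_trans (ler_norm_sum _ _ _) _.
rewrite -[m]mul1r -p1 mulr_suml; apply: ler_sum => i iD.
by rewrite normrM ger0_norm ?p0 // ler_wpM2l ?p0 ?xm.
Qed.

(* After centring the tilt, Jensen gives [1 <= Z]; for [2/3 <= m ^+ 2] the
   right-hand side exceeds the trivial bound 2. *)
Lemma tilt_tv : \sum_(i in D) `|q i - p i| <= \sum_(i in D) p i * `|y i| + 3 * m ^+ 2.
Proof.
have [m0|m0] := leP (2/3) (m ^+ 2).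
  apply: (@le_trans _ _ 2).
    apply: (@le_trans _ _ (\sum_(i in D) (q i + p i))).
      apply: ler_sum => i iD; apply: le_trans (ler_normB _ _) _.
      by rewrite !ger0_norm ?p0 ?tilt_ge0.
    by rewrite big_split /= p1 tilt_sum1.
  have : 0 <= \sum_(i in D) p i * `|y i| by apply: sumr_ge0 => i iD; rewrite mulr_ge0 ?p0.
  lra.
(* The square of 33/40 exceeds 2/3, and twice 33/40 is the range of [expR_le_quad_wide]. *)
have mlt : m <= 33/40 by nra.
have yb i : i \in D -> `|y i| <= 33/20.
  move=> iD; apply: le_trans (ler_normB _ _) _.
  have := xm iD; have := xbar_le; lra.
have Ey2 : \sum_(i in D) p i * y i ^+ 2 <= m ^+ 2.
  have -> : \sum_(i in D) p i * y i ^+ 2 = \sum_(i in D) p i * x i ^+ 2 - xbar ^+ 2.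
    have -> : \sum_(i in D) p i * y i ^+ 2 =
      \sum_(i in D) (p i * x i ^+ 2 - p i * x i * (2 * xbar) + p i * xbar ^+ 2).
      by apply: eq_bigr => i _; rewrite /y; ring.
    rewrite big_split /= sumrB -!mulr_suml p1 -/xbar; ring.
  have : \sum_(i in D) p i * x i ^+ 2 <= m ^+ 2.
    rewrite -[leRHS]mul1r -p1 mulr_suml; apply: ler_sum => i iD.
    rewrite ler_wpM2l ?p0 // -(@real_normK _ (x i)) ?num_real //.
    by rewrite lerXn2r ?nnegrE ?xm //; apply: le_trans (xm iD).
  have := sqr_ge0 xbar; lra.
have ZV : Z - 1 <= 3/2 * m ^+ 2.
  have : Z <= \sum_(i in D) (p i + p i * y i + 3/2 * (p i * y i ^+ 2)).
    apply: ler_sum => i iD; have := ler_wpM2l (p0 iD) (expR_le_quad_wide (yb _ iD)); lra.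
  rewrite !big_split /= -mulr_sumr p1 Ey; lra.
(* The remainder [expR (y i) - 1 - y i] is nonnegative with mean [Z - 1], and the normalisation
   costs another [Z - 1]. Two times 3/2 gives the constant 3 of the second-order term in the
   polytope. *)
apply: (@le_trans _ _ (\sum_(i in D) (p i * `|y i| + (p i * (expR (y i)) - p i - p i * y i) + p i * (Z - 1)))).
  apply: ler_sum => i iD; rewrite qE' //.
  have -> : p i * expR (y i) / Z - p i = p i * (expR (y i) - Z) / Z.
    by field; rewrite gt_eqF //; exact: lt_le_trans ltr01 Z1.
  rewrite !normrM (ger0_norm (p0 iD)) normfV (ger0_norm (le_trans ler01 Z1)).
  apply: (@le_trans _ _ (p i * `|expR (y i) - Z|)).
    rewrite ler_pdivrMr ?(lt_le_trans ltr01 Z1) // ler_peMr // mulr_ge0 ?p0 //.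
  have -> : p i * `|y i| + (p i * expR (y i) - p i - p i * y i) + p i * (Z - 1) =
    p i * (`|y i| + (expR (y i) - 1 - y i) + (Z - 1)) by ring.
  rewrite ler_wpM2l ?p0 //.
  have -> : expR (y i) - Z = y i + (expR (y i) - 1 - y i) - (Z - 1) by ring.
  apply: le_trans (ler_normB _ _) _; apply: lerD; last by rewrite ger0_norm // subr_ge0.
  apply: le_trans (ler_normD _ _) _; rewrite lerD2l ger0_norm //.
  have := expR_ge1Dx (y i); lra.
rewrite !big_split /= !sumrN -mulr_suml p1 Ey -/Z; lra.
Qed.

End Tilt.

(** * Mean deviation and variance of the features *)

Section MeanDeviation.
Variables (R : realType) (I : finType) (D : {set I}) (d : nat) (W : 'M[R]_d).
Variables (phi : I -> 'cV[R]_d).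
Hypothesis pW : psd W.
Implicit Types p q : I -> R.

Definition mean p := \sum_(i in D) p i *: phi i.
Definition dev p := \sum_(i in D) p i * wnorm W (phi i - mean p).

Lemma wnorm_mean_le p (m : R) : (forall i, i \in D -> 0 <= p i) -> \sum_(i in D) p i = 1 ->
  (forall i, i \in D -> wnorm W (phi i) <= m) -> wnorm W (mean p) <= m.
Proof.
move=> p0 p1 hm; apply: le_trans (wnorm_sum _ _ pW) _.
rewrite -[m]mul1r -p1 mulr_suml; apply: ler_sum => i iD.
by rewrite wnormZ ger0_norm ?p0 // ler_wpM2l ?p0 ?hm.
Qed.

(** Replacing [p] by [q] moves the mean by at most [m * t], and reweighting deviations of size at
    most [2 * m] costs [2 * m * t]. *)
Lemma dev_le_tv p q (m t : R) :
  (forall i, i \in D -> 0 <= p i) -> \sum_(i in D) p i = 1 ->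
  (forall i, i \in D -> 0 <= q i) -> \sum_(i in D) q i = 1 ->
  (forall i, i \in D -> wnorm W (phi i) <= m) ->
  \sum_(i in D) `|p i - q i| <= t ->
  dev p <= dev q + 3 * m * t.
Proof.
move=> p0 p1 q0 q1 hm ht.
have hmu : wnorm W (mean q - mean p) <= m * t.
  rewrite /mean -sumrB; apply: le_trans (wnorm_sum _ _ pW) _.
  apply: (@le_trans _ _ (m * \sum_(i in D) `|p i - q i|)).
    rewrite mulr_sumr; apply: ler_sum => i iD; rewrite -scalerBl wnormZ distrC mulrC.
    by rewrite ler_wpM2r ?hm.
  rewrite ler_wpM2l //.
  have [i iD] : exists i, i \in D.
    apply/existsP; apply: contraT; rewrite negb_exists => /forallP h.
    by move: p1; rewrite big_pred0 => [/eqP|i]; rewrite ?(negbTE (h i)) // eq_sym oner_eq0.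
  exact: le_trans (wnorm_ge0 _ _) (hm _ iD).
apply: (@le_trans _ _ (\sum_(i in D) (p i * wnorm W (phi i - mean q) + p i * (m * t)))).
  apply: ler_sum => i iD; rewrite -mulrDr ler_wpM2l ?p0 //.
  have -> : phi i - mean p = (phi i - mean q) + (mean q - mean p) by rewrite addrA subrK.
  by apply: le_trans (wnormD _ _ pW) _; rewrite lerD2l.
rewrite big_split /= -mulr_suml p1 mul1r.
apply: (@le_trans _ _ (\sum_(i in D) (q i * wnorm W (phi i - mean q) + `|p i - q i| * (2 * m)) + m * t)).
  rewrite lerD2r; apply: ler_sum => i iD.
  have b : wnorm W (phi i - mean q) <= 2 * m.
    apply: le_trans (wnormB _ _ pW) _.
    by have := hm _ iD; have := wnorm_mean_le q0 q1 hm; lra.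
  have := wnorm_ge0 W (phi i - mean q) => b0.
  have h : p i - q i <= `|p i - q i| by rewrite ler_norm.
  have h0 : 0 <= `|p i - q i| by [].
  nra.
rewrite big_split /= -mulr_suml -/(dev q) -addrA lerD2l.
have m0 : 0 <= m by apply: le_trans (wnorm_ge0 W (mean q)) (wnorm_mean_le q0 q1 hm).
nra.
Qed.

(** Jensen for the square root, obtained from the nonnegative variance of the norms under [p]. *)
Lemma dev_sqr_le p (V : 'M[R]_d) (mu : 'cV[R]_d) : psd V ->
  (forall i, i \in D -> 0 <= p i) -> \sum_(i in D) p i = 1 ->
  \sum_(i in D) p i * wnorm V (phi i - mu) <=
    Num.sqrt (\sum_(i in D) p i * qf V (phi i - mu)).
Proof.
move=> pV p0 p1; set e := \sum_(i in D) _.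
have e0 : 0 <= e by apply: sumr_ge0 => i iD; rewrite mulr_ge0 ?p0 ?wnorm_ge0.
rewrite -(ger0_norm e0) -sqrtr_sqr ler_wsqrtr //.
have : 0 <= \sum_(i in D) p i * (wnorm V (phi i - mu) - e) ^+ 2.
  by apply: sumr_ge0 => i iD; rewrite mulr_ge0 ?p0 ?sqr_ge0.
have -> : \sum_(i in D) p i * (wnorm V (phi i - mu) - e) ^+ 2 =
   \sum_(i in D) (p i * qf V (phi i - mu) - p i * wnorm V (phi i - mu) * (2 * e) + p i * e ^+ 2).
  apply: eq_bigr => i _; rewrite -wnorm_sqr //; ring.
rewrite big_split /= sumrB -!mulr_suml p1 -/e.
set s := \sum_(i in D) _; nra.
Qed.

(** Only the outcomes [i] and [j] are kept. Since [phi j = 0], the norm of [phi i] is at most the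
    sum of the distances from the mean to the two features; the weighted Cauchy-Schwarz inequality
    and [p i + p j <= 1] then give the product of the weights. *)
Lemma var_ge_pair p i j : i \in D -> j \in D -> phi j = 0 ->
  (forall i, i \in D -> 0 <= p i) -> \sum_(i in D) p i = 1 ->
  p i * p j * qf W (phi i) <= \sum_(k in D) p k * qf W (phi k - mean p).
Proof.
move=> iD jD fj p0 p1.
have [->|nij] := eqVneq i j.
  rewrite fj /qf bil0l mulr0; apply: sumr_ge0 => k kD; rewrite mulr_ge0 ?p0 //; exact: pW.2.
have rest (F : I -> R) : (forall k, k \in D -> 0 <= F k) -> F i + F j <= \sum_(k in D) F k.
  move=> F0; rewrite (bigD1 i) //= lerD2l (bigD1 j) /=; last by rewrite jD eq_sym.
  by rewrite lerDl; apply: sumr_ge0 => k /andP[/andP[kD _] _]; exact: F0.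
have pq : p i + p j <= 1 by rewrite -p1; exact: rest.
have := rest (fun k => p k * qf W (phi k - mean p)).
move=> /(_ (fun k kD => mulr_ge0 (p0 k kD) (pW.2 _))); apply: le_trans.
rewrite fj sub0r -!wnorm_sqr // wnormN.
have h : wnorm W (phi i) <= wnorm W (phi i - mean p) + wnorm W (mean p).
  by have := wnormD (phi i - mean p) (mean p) pW; rewrite subrK.
have := p0 _ iD; have := p0 _ jD; move: h pq.
move: (p i) (p j) (wnorm_ge0 W (phi i)) (wnorm_ge0 W (phi i - mean p)) (wnorm_ge0 W (mean p)).
move: (wnorm W (phi i)) (wnorm W (phi i - mean p)) (wnorm W (mean p)).
move=> n n1 n0 a b hn hn1 hn0 h ab b0 a0.
apply: (@le_trans _ _ (a * b * (n1 + n0) ^+ 2)).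
  by rewrite ler_wpM2l ?mulr_ge0 // lerXn2r ?nnegrE ?addr_ge0.
apply: (@le_trans _ _ ((a * n1 ^+ 2 + b * n0 ^+ 2) * (a + b))).
  rewrite -subr_ge0 (_ : _ - _ = (a * n1 - b * n0) ^+ 2) ?sqr_ge0 //; ring.
by rewrite -[leRHS]mulr1 ler_wpM2l // addr_ge0 // mulr_ge0 ?sqr_ge0.
Qed.

End MeanDeviation.

(** * Directional derivatives *)

Section DirectionalDerivatives.
Variables (R : realType) (d : nat).
Implicit Types (x v : 'cV[R]_d) (g h : 'cV[R]_d -> R).

(** Restriction to the line through [x] along [v], which makes the one-variable chain rule
    available. *)
Lemma is_derive_line g x v (b : R) :
  is_derive x v g b <-> is_derive (0 : R) 1 (fun t : R => g (t *: v + x)) b.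
Proof.
have e : (fun h0 : R => h0^-1 *: ((g \o shift x) (h0 *: v) - g x)) =
  (fun h0 : R => h0^-1 *: (((fun t : R => g (t *: v + x)) \o shift 0) (h0 *: 1) - (fun t : R => g (t *: v + x)) 0)).
  by apply/funext => h0 /=; rewrite addr0 scale0r add0r /GRing.scale /= mulr1.
split => -[h1 h2].
  by split; [move: h1; rewrite /derivable e|move: h2; rewrite /derive e].
by split; [move: h1; rewrite /derivable -e|move: h2; rewrite /derive -e].
Qed.

Lemma is_derive_comp_real (f : R -> R) g x v (a b : R) :
  is_derive x v g b -> is_derive (g x) 1 f a ->
  is_derive x v (fun t => f (g t)) (b * a).
Proof.
move=> /is_derive_line hg hf; apply/is_derive_line.
rewrite mulrC.
have hf' : is_derive ((fun t : R => g (t *: v + x)) 0) 1 f a by rewrite scale0r add0r.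
exact: (@is_derive1_comp _ f (fun t : R => g (t *: v + x)) 0 a b hf' hg).
Qed.

Lemma is_derive_dotv (y x v : 'cV[R]_d) : is_derive x v (fun t => dotv y t) (dotv y v).
Proof.
apply/is_derive_line.
have -> : (fun t : R => dotv y (t *: v + x)) = (dotv y v \*: (@id R)) \+ cst (dotv y x).
  by apply/funext => t /=; rewrite !dotv_bil bilDr bilZr mulrC.
apply: is_derive_eq; rewrite addr0 /GRing.scale /=; exact: mulr1.
Qed.

Lemma is_derive_sum_pred (I : Type) (r : seq I) (P : pred I) (F : I -> 'cV[R]_d -> R) (dF : I -> R) x v :
  (forall i, is_derive x v (F i) (dF i)) ->
  is_derive x v (fun t => \sum_(i <- r | P i) F i t) (\sum_(i <- r | P i) dF i).
Proof.
move=> h; elim: r => [|i r IH].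
  rewrite big_nil; have -> : (fun t => \sum_(i <- [::] | P i) F i t) = cst 0.
    by apply/funext => t; rewrite big_nil.
  exact: is_derive_cst.
rewrite big_cons; case: ifP => Pi.
  have -> : (fun t => \sum_(i <- i :: r | P i) F i t) = F i \+ (fun t => \sum_(i <- r | P i) F i t).
    by apply/funext => t; rewrite big_cons Pi.
  exact: is_deriveD.
have -> // : (fun t => \sum_(i <- i :: r | P i) F i t) = (fun t => \sum_(i <- r | P i) F i t).
by apply/funext => t; rewrite big_cons Pi.
Qed.

Lemma is_derive_divr g h x v (dg dh : R) : h x != 0 ->
  is_derive x v g dg -> is_derive x v h dh ->
  is_derive x v (fun t => g t / h t) (dg / h x - g x * dh / h x ^+ 2).
Proof.
move=> hx Hg Hh.
have Hi : is_derive (h x) 1 (fun y : R => y^-1) (- (h x ^+ 2)^-1).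
  have -> : - (h x ^+ 2)^-1 = - (h x) ^-2 *: (1 : R) by rewrite /GRing.scale /= mulr1.
  exact: (@is_deriveV _ id (h x) 1 1 hx).
have H := @is_deriveM _ _ g (fun t => (h t)^-1) x v _ _ Hg (is_derive_comp_real Hh Hi).
apply: is_derive_eq H _.
rewrite /GRing.scale /=; ring.
Qed.

End DirectionalDerivatives.

(** * The logit model and the Hessian of its loss *)

Section MNLModel.
Variables (R : realType) (S A : finType) (d : nat).
Variables (Ssa : S -> A -> {set S}) (phi : S -> A -> S -> 'cV[R]_d).
Hypothesis Ssa0 : forall s a, exists s', s' \in Ssa s a.
Implicit Types (th v : 'cV[R]_d) (s : S) (a : A).
Local Notation p := (pmnl Ssa phi).
Local Notation Zsum th s a := (\sum_(j in Ssa s a) expR (dotv (phi s a j) th)).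

Lemma Zsum_gt0 th s a : 0 < Zsum th s a.
Proof.
have [s' hs'] := Ssa0 s a.
rewrite (bigD1 s') //= ltr_pwDl ?expR_gt0 //; apply: sumr_ge0 => i _; exact: expR_ge0.
Qed.

Lemma pmnlE th s a s' : s' \in Ssa s a ->
  p th s a s' = expR (dotv (phi s a s') th) / Zsum th s a.
Proof. by rewrite /pmnl => ->. Qed.

Lemma pmnl_out th s a s' : s' \notin Ssa s a -> p th s a s' = 0.
Proof. by rewrite /pmnl => /negbTE ->. Qed.

Lemma pmnl_ge0 th s a s' : 0 <= p th s a s'.
Proof.
rewrite /pmnl; case: ifP => // _.
by rewrite divr_ge0 ?expR_ge0 // ltW // Zsum_gt0.
Qed.

Lemma pmnl_sum th s a : \sum_(s' in Ssa s a) p th s a s' = 1.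
Proof.
rewrite (eq_bigr (fun j => expR (dotv (phi s a j) th) / Zsum th s a)); last first.
  by move=> j hj; rewrite pmnlE.
by rewrite -mulr_suml mulfV // gt_eqF // Zsum_gt0.
Qed.

Lemma pmnl_sumT th s a (F : S -> R) :
  \sum_s' p th s a s' * F s' = \sum_(s' in Ssa s a) p th s a s' * F s'.
Proof.
rewrite (bigID (fun s' => s' \in Ssa s a)) /= [X in _ + X]big1 ?addr0 // => i hi.
by rewrite pmnl_out // mul0r.
Qed.

Lemma pmnl_sum_all th s a : \sum_s' p th s a s' = 1.
Proof.
rewrite -(pmnl_sum th s a) -[RHS](eq_bigr _ (fun j _ => mulr1 (p th s a j))) -pmnl_sumT.
by apply: eq_bigr => j _; rewrite mulr1.
Qed.

Lemma pmnl_le1 th s a s' : p th s a s' <= 1.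
Proof.
rewrite -(pmnl_sum_all th s a) (bigD1 s') //= lerDl; apply: sumr_ge0 => i _.
exact: pmnl_ge0.
Qed.

(** A change of parameter is an exponential tilt with exponents [dotv (phi s a j) (th' - th)], so
    [tilt_tv] applies. *)
Lemma pmnl_tilt th th' s a s' : s' \in Ssa s a ->
  p th' s a s' = p th s a s' * expR (dotv (phi s a s') (th' - th)) /
    \sum_(j in Ssa s a) p th s a j * expR (dotv (phi s a j) (th' - th)).
Proof.
move=> hs'.
have E j : expR (dotv (phi s a j) th') = expR (dotv (phi s a j) th) * expR (dotv (phi s a j) (th' - th)).
  by rewrite -expRD !dotv_bil -bilDr addrC subrK.
have -> : \sum_(j in Ssa s a) p th s a j * expR (dotv (phi s a j) (th' - th)) = Zsum th' s a / Zsum th s a.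
  rewrite mulr_suml; apply: eq_bigr => j hj; rewrite pmnlE // E; ring.
rewrite !pmnlE // E; field.
by rewrite !gt_eqF ?Zsum_gt0.
Qed.

Let meanp th s a := mean (Ssa s a) (phi s a) (p th s a).

Lemma is_derive_Z th v s a :
  is_derive th v (fun t => Zsum t s a)
    (\sum_(j in Ssa s a) dotv (phi s a j) v * expR (dotv (phi s a j) th)).
Proof.
apply: is_derive_sum_pred => j.
exact: is_derive_comp_real (is_derive_dotv _ _ _) (is_derive_expR _).
Qed.

Lemma loss_in s a sn th : sn \in Ssa s a ->
  loss Ssa phi s a sn th = ln (Zsum th s a) - dotv (phi s a sn) th.
Proof.
move=> hsn; rewrite /loss (bigD1 sn) //= eqxx mul1r big1 ?addr0; last first.
  by move=> j /andP[_ /negbTE hj]; rewrite eq_sym hj mul0r.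
rewrite pmnlE // ln_div ?posrE ?expR_gt0 ?Zsum_gt0 // expRK; ring.
Qed.

Lemma is_derive_loss s a sn th v : sn \in Ssa s a ->
  is_derive th v (loss Ssa phi s a sn)
    (\sum_(j in Ssa s a) p th s a j * dotv (phi s a j) v - dotv (phi s a sn) v).
Proof.
move=> hsn.
have -> : loss Ssa phi s a sn = (fun t => ln (Zsum t s a)) - (fun t => dotv (phi s a sn) t).
  by apply/funext => t; rewrite loss_in.
have -> : \sum_(j in Ssa s a) p th s a j * dotv (phi s a j) v =
  (\sum_(j in Ssa s a) dotv (phi s a j) v * expR (dotv (phi s a j) th)) * (Zsum th s a)^-1.
  rewrite mulr_suml; apply: eq_bigr => j hj; rewrite pmnlE //; ring.
apply: is_deriveB (is_derive_dotv _ _ _).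
apply: is_derive_comp_real (is_derive_Z _ _ _ _) _.
by apply: is_derive1_ln; exact: Zsum_gt0.
Qed.

Lemma is_derive_pmnl s a j th v : j \in Ssa s a ->
  is_derive th v (fun t => p t s a j)
    (p th s a j * (dotv (phi s a j) v - \sum_(k in Ssa s a) p th s a k * dotv (phi s a k) v)).
Proof.
move=> hj.
have -> : (fun t => p t s a j) = (fun t => expR (dotv (phi s a j) t) / Zsum t s a).
  by apply/funext => t; rewrite pmnlE.
have Z0 : Zsum th s a != 0 by rewrite gt_eqF ?Zsum_gt0.
have H := is_derive_divr Z0 (is_derive_comp_real (is_derive_dotv (phi s a j) th v) (is_derive_expR _))
  (is_derive_Z th v s a).
apply: is_derive_eq H _; rewrite pmnlE //.
have -> : \sum_(j in Ssa s a) p th s a j * dotv (phi s a j) v =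
  (\sum_(j in Ssa s a) dotv (phi s a j) v * expR (dotv (phi s a j) th)) / (Zsum th s a).
  rewrite mulr_suml; apply: eq_bigr => k hk; rewrite pmnlE //; ring.
by field.
Qed.

Lemma dotv_evec (x : 'cV[R]_d) i : dotv x (evec R i) = x i 0.
Proof.
rewrite /dotv /evec mxE (bigD1 i) //= big1 ?addr0.
  by rewrite !mxE !eqxx mulr1.
by move=> j /negbTE hj; rewrite !mxE hj mulr0.
Qed.

(** The observed successor enters the loss only through a linear term, so it vanishes from the
    Hessian, which is the covariance of the features under the model. *)
Lemma hess_loss s a sn th : sn \in Ssa s a ->
  hess (loss Ssa phi s a sn) th =
  \sum_(j in Ssa s a) p th s a j *:
     ((phi s a j - meanp th s a) *m (phi s a j - meanp th s a)^T).
Proof.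
move=> hsn; apply/matrixP => i l; rewrite mxE.
have -> : (fun th0 => 'D_(evec R i) (loss Ssa phi s a sn) th0) =
  (fun t => \sum_(j in Ssa s a) p t s a j * phi s a j i 0) - cst (phi s a sn i 0).
  apply/funext => t; rewrite (@derive_val _ _ _ _ _ _ _ (is_derive_loss t (evec R i) hsn)).
  by rewrite dotv_evec; congr (_ - _); apply: eq_bigr => j _; rewrite dotv_evec.
pose dp j := p th s a j * (phi s a j l 0 - \sum_(k in Ssa s a) p th s a k * phi s a k l 0).
(* The sum rule wants a derivative for every index; outside [Ssa s a] the summand is identically 0,
   hence the conditional. *)
have H : is_derive th (evec R l) (fun t => \sum_(j in Ssa s a) p t s a j * phi s a j i 0)
   (\sum_(j in Ssa s a) (if j \in Ssa s a then dp j * phi s a j i 0 else 0)).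
  apply: is_derive_sum_pred => j; case: ifP => hj; last first.
    have -> : (fun t => p t s a j * phi s a j i 0) = cst 0.
      by apply/funext => t; rewrite pmnl_out ?hj // mul0r.
    exact: is_derive_cst.
  have -> : dp j = (p th s a j * (dotv (phi s a j) (evec R l) - \sum_(k in Ssa s a) p th s a k * dotv (phi s a k) (evec R l))).
    rewrite /dp dotv_evec; congr (_ * (_ - _)).
    by apply: eq_bigr => k _; rewrite dotv_evec.
  have Hp := is_derive_pmnl th (evec R l) hj.
  apply: is_derive_eq (is_deriveM Hp (is_derive_cst (phi s a j i 0) th (evec R l))) _.
  by rewrite /GRing.scale /= mulr0 add0r mulrC.
rewrite (@derive_val _ _ _ _ _ _ _ (is_deriveB H (is_derive_cst _ _ _))) subr0.
have mE k : meanp th s a k 0 = \sum_(j in Ssa s a) p th s a j * phi s a j k 0.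
  by rewrite /meanp /mean summxE; apply: eq_bigr => j _; rewrite mxE.
rewrite summxE -/(meanp th s a).
transitivity (\sum_(j in Ssa s a) (p th s a j * phi s a j i 0 * phi s a j l 0 - p th s a j * phi s a j i 0 * meanp th s a l 0)).
  apply: eq_bigr => j hj; rewrite hj /dp -mE; ring.
rewrite sumrB -mulr_suml -mE.
under [RHS]eq_bigr => j hj.
  rewrite mxE [X in _ * X]mxE big_ord1 !mxE -/(meanp th s a).
  have -> : p th s a j * ((phi s a j i 0 - meanp th s a i 0) * (phi s a j l 0 - meanp th s a l 0)) =
    p th s a j * phi s a j i 0 * phi s a j l 0 - p th s a j * phi s a j i 0 * meanp th s a l 0
    - p th s a j * phi s a j l 0 * meanp th s a i 0 + p th s a j * (meanp th s a i 0 * meanp th s a l 0) by ring.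
  over.
rewrite big_split /= !sumrB -!mulr_suml pmnl_sum -!mE; ring.
Qed.

(** The square roots of the weights make the covariance a plain sum of outer products, as [addouter]
    requires. *)
Definition hvecs th s a : seq 'cV[R]_d :=
  [seq Num.sqrt (p th s a j) *: (phi s a j - meanp th s a) | j <- enum (Ssa s a)].

Lemma hess_addouter s a sn th (M : 'M[R]_d) : sn \in Ssa s a ->
  M + hess (loss Ssa phi s a sn) th = addouter M (hvecs th s a).
Proof.
move=> hsn; rewrite hess_loss // /addouter; congr (_ + _).
rewrite /hvecs big_map big_enum /=; apply: eq_bigr => j _.
by rewrite linearZ /= -scalemxAl -scalemxAr scalerA -expr2 sqr_sqrtr // pmnl_ge0.
Qed.

Lemma qf_hvecs (M : 'M[R]_d) th s a :
  \sum_(w <- hvecs th s a) qf M w =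
  \sum_(j in Ssa s a) p th s a j * qf M (phi s a j - meanp th s a).
Proof.
rewrite /hvecs big_map big_enum /=; apply: eq_bigr => j _.
by rewrite /qf bilZl bilZr mulrA -expr2 sqr_sqrtr // pmnl_ge0.
Qed.

End MNLModel.

(** * Values, optimism and concentration *)

Section Values.
Variables (R : realType) (S A : finType) (d : nat).
Variables (Ssa : S -> A -> {set S}) (phi : S -> A -> S -> 'cV[R]_d).
Variables (r : S -> A -> R) (gamma : R) (ths : 'cV[R]_d) (a0 : A).
Hypothesis Ssa0 : forall s a, exists s', s' \in Ssa s a.
Hypothesis gamma01 : 0 <= gamma < 1.
Hypothesis r01 : forall s a, 0 <= r s a <= 1.
Local Notation p := (pmnl Ssa phi ths).
Local Notation Vmax := ((1 - gamma)^-1).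
Local Notation Vf := (Vfin Ssa phi r gamma ths).
Local Notation Vp := (Vpi Ssa phi r gamma ths).
Implicit Types (pol : hpolicy S A) (s : S) (a : A) (rest : seq S).

Let g0 : 0 <= gamma. Proof. by case/andP: gamma01. Qed.
Let g1 : gamma < 1. Proof. by case/andP: gamma01. Qed.
Let p0 s a s' : 0 <= p s a s'. Proof. exact: pmnl_ge0. Qed.

Lemma Vmax_gt0 : 0 < Vmax. Proof. by rewrite invr_gt0 subr_gt0. Qed.
Lemma Vmax_fix : Vmax = 1 + gamma * Vmax.
Proof. by field; rewrite subr_eq0 gt_eqF. Qed.
Lemma Vmax_ge1 : 1 <= Vmax.
Proof. by rewrite Vmax_fix lerDl mulr_ge0 // ltW // Vmax_gt0. Qed.

Lemma mean_le_cst (D : {set S}) (q F : S -> R) (b : R) :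
  (forall s, s \in D -> 0 <= q s) -> \sum_(s in D) q s = 1 ->
  (forall s, F s <= b) -> \sum_(s in D) q s * F s <= b.
Proof.
move=> q0 q1 h; rewrite -[b]mul1r -q1 mulr_suml; apply: ler_sum => s sD.
by rewrite ler_wpM2l ?q0.
Qed.

Lemma pmnl_mean_le s a (F : S -> R) (b : R) :
  (forall s', F s' <= b) -> \sum_s' p s a s' * F s' <= b.
Proof.
move=> h; rewrite pmnl_sumT; apply: mean_le_cst => //; exact: pmnl_sum.
Qed.

Lemma pmnl_mean_ge s a (F : S -> R) (b : R) :
  (forall s', b <= F s') -> b <= \sum_s' p s a s' * F s'.
Proof.
move=> h; rewrite -lerN2 -sumrN.
under eq_bigr do rewrite -mulrN.
by apply: pmnl_mean_le => s'; rewrite lerN2.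
Qed.

Lemma Vfin_ge0 pol H s rest : 0 <= Vf pol H s rest.
Proof.
elim: H rest => [|H IH] rest //=; rewrite addr_ge0 //.
  by case/andP: (r01 (last s rest) (pol s rest)).
by rewrite mulr_ge0 //; apply: sumr_ge0 => s' _; rewrite mulr_ge0.
Qed.

Lemma Vfin_le pol H s rest : Vf pol H s rest <= Vmax.
Proof.
elim: H rest => [|H IH] rest /=; first by rewrite ltW // Vmax_gt0.
rewrite [leRHS]Vmax_fix lerD //; first by case/andP: (r01 (last s rest) (pol s rest)).
by rewrite ler_wpM2l // pmnl_mean_le.
Qed.

Lemma Vfin_mono pol H s rest : Vf pol H s rest <= Vf pol H.+1 s rest.
Proof.
elim: H rest => [|H IH] rest; first exact: Vfin_ge0.
rewrite /= lerD2l ler_wpM2l //; apply: ler_sum => s' _.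
by rewrite ler_wpM2l //; exact: IH.
Qed.

Lemma Vfin_cvg pol s rest : Vf pol H s rest @[H --> \oo] --> Vp pol s rest.
Proof.
apply: nondecreasing_is_cvgn.
  by apply/nondecreasing_seqP => n; exact: Vfin_mono.
by exists Vmax => _ [n _ <-]; exact: Vfin_le.
Qed.

Lemma Vpi_le_of pol s rest (b : R) : (forall H, Vf pol H s rest <= b) -> Vp pol s rest <= b.
Proof.
move=> h; rewrite /Vpi; apply: limr_le.
  by apply/cvg_ex; exists (Vp pol s rest); exact: Vfin_cvg.
by apply: nearW => n; exact: h.
Qed.

Lemma Vpi_ge0 pol s rest : 0 <= Vp pol s rest.
Proof.
rewrite /Vpi; apply: limr_ge.
  by apply/cvg_ex; exists (Vp pol s rest); exact: Vfin_cvg.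
by apply: nearW => n; exact: Vfin_ge0.
Qed.

Lemma Vpi_le pol s rest : Vp pol s rest <= Vmax.
Proof. by apply: Vpi_le_of => H; exact: Vfin_le. Qed.

(** Pass to the limit on both sides of the recursion for [Vfin]; the shifted sequence has the same
    limit. *)
Lemma Vpi_bellman pol s rest : let a := pol s rest in
  Vp pol s rest = r (last s rest) a + gamma * \sum_s' p (last s rest) a s' * Vp pol s (rcons rest s').
Proof.
move=> a.
have h1 : Vf pol H.+1 s rest @[H --> \oo] --> Vp pol s rest.
  by have := @Vfin_cvg pol s rest; rewrite -(cvg_shiftS (fun H => Vf pol H s rest)).
have h2 : Vf pol H.+1 s rest @[H --> \oo] -->
    r (last s rest) a + gamma * \sum_s' p (last s rest) a s' * Vp pol s (rcons rest s').
  apply: cvgD; first exact: cvg_cst.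
  apply: cvgMl_tmp; apply: cvg_big => [|s' _]; first exact: add_continuous.
  by apply: cvgMl_tmp; exact: Vfin_cvg.
by rewrite -(cvg_lim (@Rhausdorff R) h1) -(cvg_lim (@Rhausdorff R) h2).
Qed.

(** * Optimistic value iteration over a set of kernels *)

Section ValueIteration.
Variable P : (S -> A -> S -> R) -> Prop.
Hypothesis P0 : forall q, P q -> forall s a s', 0 <= q s a s'.
Hypothesis P1 : forall q, P q -> forall s a, \sum_(s' in Ssa s a) q s a s' = 1.
Local Notation Q := (devi_iter Ssa r gamma a0 P).
Local Notation V n s := (amax a0 (Q n s)).
Let E n s a := [set x | exists q, P q /\ x = \sum_(s' in Ssa s a) q s a s' * V n s'].

Lemma le_amax (f : A -> R) a : f a <= amax a0 f.
Proof. exact: le_bigmax. Qed.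
Lemma amax_le (f : A -> R) b : (forall a, f a <= b) -> amax a0 f <= b.
Proof. by move=> h; apply: bigmax_le => // a _; exact: h. Qed.

Lemma QS n s a : Q n.+1 s a = r s a + gamma * sup (E n s a). Proof. by []. Qed.

Lemma Q_bounds n s a : 0 <= Q n s a <= Vmax.
Proof.
elim: n s a => [|n IH] s a; first by rewrite /= lexx ltW // Vmax_gt0.
have VM s' : V n s' <= Vmax by apply: amax_le => b; case/andP: (IH s' b).
have V0 s' : 0 <= V n s' by apply: le_trans (le_amax _ a0); case/andP: (IH s' a0).
have /andP[h0 hM] : 0 <= sup (E n s a) <= Vmax.
  have ub : ubound (E n s a) Vmax.
    move=> _ [q [Pq ->]]; apply: mean_le_cst => // [s' _|]; first exact: P0.
    exact: P1.
  (* For an empty set of kernels [sup] is 0, which is within the bounds. *)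
  have [->|] := eqVneq (E n s a) set0; first by rewrite sup0 lexx ltW // Vmax_gt0.
  move/set0P => [x Ex]; apply/andP; split; last by apply: ge_sup => //; exists x.
  apply: le_trans (@ub_le_sup _ (E n s a) _ x Ex); last by exists Vmax.
  case: Ex => q [Pq ->]; apply: sumr_ge0 => s' _; by rewrite mulr_ge0 ?P0.
have /andP[r0 r1] := r01 s a.
rewrite QS addr_ge0 ?mulr_ge0 //= [leRHS]Vmax_fix lerD //.
by rewrite ler_wpM2l.
Qed.

Lemma V_bounds n s : 0 <= V n s <= Vmax.
Proof.
apply/andP; split; first by apply: le_trans (le_amax _ a0); case/andP: (Q_bounds n s a0).
by apply: amax_le => b; case/andP: (Q_bounds n s b).
Qed.

Lemma E_ubound n s a : has_ubound (E n s a).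
Proof.
exists Vmax => _ [q [Pq ->]]; apply: mean_le_cst => [s' _||s']; [exact: P0|exact: P1|].
by case/andP: (V_bounds n s').
Qed.

Hypothesis Pp : P p.

(** The start value [Vmax] dominates the return of any horizon, so after [n] sweeps whatever lies
    beyond the first [n] steps is already covered; each sweep may choose the true kernel. The
    induction needs all horizons and histories at once. *)
Lemma optimism n pol H s rest : Vf pol H s rest <= V n (last s rest).
Proof.
elim: n H s rest => [|n IH] H s rest.
  apply: le_trans (le_amax _ a0); exact: Vfin_le.
case: H => [|H]; first by case/andP: (V_bounds n.+1 (last s rest)).
apply: le_trans (le_amax _ (pol s rest)).
rewrite QS /= lerD2l ler_wpM2l // pmnl_sumT.
apply: (@le_trans _ _ (\sum_(s' in Ssa (last s rest) (pol s rest)) p (last s rest) (pol s rest) s' * V n s')).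
  apply: ler_sum => s' _; rewrite ler_wpM2l //.
  by have := IH H s (rcons rest s'); rewrite last_rcons.
by apply: ub_le_sup; [exact: E_ubound|exists p].
Qed.

Lemma optimism_Vpi n pol s rest : Vp pol s rest <= V n (last s rest).
Proof. by apply: Vpi_le_of => H; exact: optimism. Qed.

Lemma optimism_Vstar n s : Vstar Ssa phi r gamma ths s <= V n s.
Proof.
apply: ge_sup; first by exists (Vp (fun _ _ => a0) s [::]); exists (fun _ _ => a0).
by move=> _ [pol ->]; exact: (optimism_Vpi n pol s [::]).
Qed.

(** The first sweep loses at most 1, since [Vmax = 1 + gamma * Vmax] and rewards are nonnegative;
    each later sweep contracts the loss by [gamma]. *)
Lemma V_gap n s : V n s <= V n.+1 s + gamma ^+ n.
Proof.
suff h m s' a : Q m s' a <= Q m.+1 s' a + gamma ^+ m.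
  by apply: amax_le => a; apply: le_trans (h n s a) _; rewrite lerD2r le_amax.
elim: m s' a => [|m IH] s' a.
  rewrite QS expr0 /=.
  have hs : Vmax <= sup (E 0 s' a).
    apply: ub_le_sup; first exact: E_ubound.
    exists p; split => //.
    have aV : amax a0 (fun _ : A => Vmax) = Vmax.
      by apply/le_anti; rewrite amax_le //= (le_amax (fun _ : A => Vmax) a0).
    transitivity (\sum_(t in Ssa s' a) p s' a t * Vmax); first by rewrite -mulr_suml pmnl_sum // mul1r.
    by apply: eq_bigr => t _; congr (_ * _); exact: esym aV.
  have := Vmax_fix; have /andP[rr _] := r01 s' a.
  have := ler_wpM2l g0 hs; lra.
rewrite !QS -addrA lerD2l exprS -mulrDr ler_wpM2l //.
apply: ge_sup; first by exists (\sum_(t in Ssa s' a) p s' a t * V m t); exists p.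
move=> _ [q [Pq ->]].
apply: (@le_trans _ _ (\sum_(t in Ssa s' a) q s' a t * V m.+1 t + gamma ^+ m)); last first.
  by rewrite lerD2r; apply: ub_le_sup; [exact: E_ubound|exists q].
have -> : gamma ^+ m = \sum_(t in Ssa s' a) q s' a t * gamma ^+ m.
  by rewrite -mulr_suml P1 // mul1r.
rewrite -big_split /=.
apply: ler_sum => t _; rewrite -mulrDr ler_wpM2l ?P0 //.
by apply: amax_le => b; apply: le_trans (IH t b) _; rewrite lerD2r le_amax.
Qed.

(** Makes the last iterate an approximate fixed point under the true kernel: changing the kernel
    costs [rho * Vmax], and replacing the previous iterate by the current one costs the truncation
    term. *)
Lemma Q_upper n s a rho :
  (forall q, P q -> \sum_(s' in Ssa s a) `|q s a s' - p s a s'| <= rho) ->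
  Q n.+1 s a <= r s a + gamma * (\sum_s' p s a s' * V n.+1 s')
                + gamma * rho * Vmax + gamma ^+ n.+1.
Proof.
move=> h; rewrite QS -!addrA lerD2l exprS -mulrA -!mulrDr ler_wpM2l //.
apply: ge_sup; first by exists (\sum_(t in Ssa s a) p s a t * V n t); exists p.
move=> _ [q [Pq ->]].
apply: (@le_trans _ _ (\sum_(t in Ssa s a) (p s a t * V n.+1 t + `|q s a t - p s a t| * Vmax + p s a t * gamma ^+ n))).
  apply: ler_sum => t _.
  have /andP[v0 vM] := V_bounds n t; have gap := V_gap n t.
  have := ler_wpM2l (p0 s a t) gap.
  have := ler_norm (q s a t - p s a t); have := normr_ge0 (q s a t - p s a t).
  nra.
rewrite !big_split /= -!mulr_suml pmnl_sum // mul1r pmnl_sumT -addrA lerD2l lerD2r.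
by rewrite ler_wpM2r ?h // ltW // Vmax_gt0.
Qed.

End ValueIteration.
End Values.

(** * Expectations over trajectories and concentration *)

Section TrajectoryTree.
Variables (R : realType) (S A : finType) (d : nat).
Variables (Ssa : S -> A -> {set S}) (phi : S -> A -> S -> 'cV[R]_d).
Variables (ths : 'cV[R]_d) (pol : hpolicy S A) (s1 : S).
Hypothesis Ssa0 : forall s a, exists s', s' \in Ssa s a.
Local Notation p rest := (pmnl Ssa phi ths (last s1 rest) (pol s1 rest)).
Implicit Types (rest w : seq S) (g h : seq S -> R).

(** The recursion of [prob] with a real function in place of an event, so that exponential weights
    can be integrated. *)
Fixpoint expect n rest g : R :=
  if n is n'.+1 then \sum_s' p rest s' * expect n' (rcons rest s') g else g rest.

Lemma prob_expect n rest (E : seq S -> Prop) :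
  prob Ssa phi ths pol n s1 rest E = expect n rest (fun w => if `[< E w >] then 1 else 0).
Proof. by elim: n rest => //= n IH rest; apply: eq_bigr => s' _; rewrite IH. Qed.

(** Comparison on feasible continuations is enough because every other successor has probability
    0. *)
Lemma expect_le n rest g h :
  (forall w, size w = n -> feasible_from Ssa pol s1 rest w -> g (rest ++ w) <= h (rest ++ w)) ->
  expect n rest g <= expect n rest h.
Proof.
elim: n rest => [|n IH] rest H /=; first by have := H [::] erefl I; rewrite cats0.
apply: ler_sum => s' _.
have [hs'|hs'] := boolP (s' \in Ssa (last s1 rest) (pol s1 rest)); last first.
  by rewrite pmnl_out // !mul0r.
rewrite ler_wpM2l ?pmnl_ge0 //; apply: IH => w sw fw.
by rewrite cat_rcons; apply: H => /=; [rewrite sw|].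
Qed.

Lemma expectB n rest g h : expect n rest (fun w => g w - h w) = expect n rest g - expect n rest h.
Proof.
elim: n rest => //= n IH rest; rewrite -sumrB; apply: eq_bigr => s' _.
by rewrite IH mulrBr.
Qed.

Lemma expectM n rest (c : R) g : expect n rest (fun w => g w * c) = expect n rest g * c.
Proof.
elim: n rest => //= n IH rest; rewrite mulr_suml; apply: eq_bigr => s' _.
by rewrite IH mulrA.
Qed.

Variables (X : seq S -> S -> R) (c : R).
Hypothesis c0 : 0 < c.
Hypothesis Xmean : forall rest, \sum_s' p rest s' * X rest s' = 0.
Hypothesis Xc : forall rest s', `|X rest s'| <= c.

Definition mart rest : R := \sum_(i < size rest) X (take i rest) (nth s1 rest i).

Lemma mart_rcons rest s' : mart (rcons rest s') = mart rest + X rest s'.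
Proof.
rewrite /mart size_rcons big_ord_recr /= -cats1 take_size_cat // nth_cat ltnn subnn /=; congr (_ + _).
apply: eq_bigr => i _; rewrite nth_cat ltn_ord take_cat ltn_ord //.
Qed.

(** In [expR_le_quad] the linear term averages to 0, so one step costs the factor
    [1 + (mu * c) ^+ 2], at most its exponential. *)
Lemma expect_exp_mart n rest (mu : R) : 0 <= mu -> mu * c <= 1 ->
  expect n rest (fun w => expR (mu * mart w)) <= expR (mu * mart rest) * expR ((mu * c) ^+ 2 *+ n).
Proof.
move=> mu0 mc; elim: n rest => [|n IH] rest /=; first by rewrite mulr0n expR0 mulr1.
apply: (@le_trans _ _ (\sum_s' p rest s' * (expR (mu * mart rest) * expR ((mu * c) ^+ 2 *+ n) *
   (1 + mu * X rest s' + (mu * c) ^+ 2)))).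
  apply: ler_sum => s' _; rewrite ler_wpM2l ?pmnl_ge0 //.
  apply: le_trans (IH _) _; rewrite mart_rcons mulrDr expRD mulrAC.
  rewrite ler_wpM2l ?mulr_ge0 ?expR_ge0 //.
  have Xb : `|mu * X rest s'| <= mu * c by rewrite normrM ger0_norm // ler_wpM2l.
  apply: le_trans (expR_le_quad (le_trans Xb mc)) _.
  rewrite lerD2l -(@real_normK _ (mu * X rest s')) ?num_real //.
  by rewrite lerXn2r ?nnegrE ?mulr_ge0 // ltW.
set C := _ * _.
have -> : \sum_s' p rest s' * (C * (1 + mu * X rest s' + (mu * c) ^+ 2)) =
  C * (1 + (mu * c) ^+ 2).
  transitivity (\sum_s' (p rest s' * (C * (1 + (mu * c) ^+ 2)) + p rest s' * X rest s' * (C * mu))).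
    by apply: eq_bigr => s' _; ring.
  by rewrite big_split /= -!mulr_suml pmnl_sum_all // Xmean; ring.
rewrite mulrS expRD mulrCA mulrC ler_wpM2r //.
  by rewrite /C mulr_ge0 ?expR_ge0.
exact: expR_ge1Dx.
Qed.

(** Instead of a union of bad events, the indicator of [E1] minus the Chernoff weight
    [expR (mu * (mart w - a))] is a pointwise lower bound for the indicator of [E]: beyond the
    threshold the weight is at least 1. Its mean is at least [1 - delta - delta]. *)
Lemma azuma_union (E1 E : seq S -> Prop) (delta : R) (n T : nat) :
  (n <= T)%N -> (0 < T)%N -> 0 < delta ->
  1 - delta <= prob Ssa phi ths pol n s1 [::] E1 ->
  (forall w, size w = n -> feasible Ssa pol s1 w -> E1 w ->
     mart w <= c * Num.sqrt T%:R * (1 - ln delta) -> E w) ->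
  1 - 2 * delta <= prob Ssa phi ths pol n s1 [::] E.
Proof.
move=> nT T0 d0 h1 h.
have sT0 : 0 < Num.sqrt T%:R :> R by rewrite sqrtr_gt0 ltr0n.
set a := c * Num.sqrt T%:R * (1 - ln delta) in h.
(* This [mu] turns the Chernoff exponent into [ln delta]. *)
pose mu := (c * Num.sqrt T%:R)^-1.
have mu0 : 0 < mu by rewrite invr_gt0 mulr_gt0.
have muc : mu * c = (Num.sqrt T%:R)^-1 by rewrite /mu; field; rewrite !gt_eqF.
have mc1 : mu * c <= 1.
  by rewrite muc invf_le1 // -[leLHS]sqrtr1 ler_wsqrtr // (ler_nat R 1).
have mua : mu * a = 1 - ln delta by rewrite /mu /a; field; rewrite !gt_eqF.
apply: (@le_trans _ _ (expect n [::] (fun w => (if `[< E1 w >] then 1 else 0) - expR (mu * mart w) * expR (- (mu * a))))).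
  rewrite expectB -prob_expect.
  have := expect_exp_mart n [::] (ltW mu0) mc1.
  rewrite /mart big_ord0 mulr0 expR0 mul1r -/mart => he.
  rewrite expectM.
  have : expect n [::] (fun w => expR (mu * mart w)) * expR (- (mu * a)) <= delta.
    apply: (@le_trans _ _ (expR ((mu * c) ^+ 2 *+ n) * expR (- (mu * a)))).
      by rewrite ler_wpM2r ?expR_ge0.
    rewrite -expRD mua -[leRHS](lnK d0) ler_expR.
    have : (mu * c) ^+ 2 *+ n <= 1.
      rewrite muc exprVn sqr_sqrtr ?ler0n // -mulr_natl ler_pdivrMr ?ltr0n // mul1r.
      by rewrite ler_nat.
    lra.
  lra.
rewrite prob_expect; apply: expect_le => w sw fw /=.
have e0 := expR_gt0 (mu * mart w) ; have e1 := expR_gt0 (- (mu * a)).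
have e2 : 0 < expR (mu * mart w) * expR (- (mu * a)) by rewrite mulr_gt0.
case: (asboolP (E1 w)) => H1; last by case: ifP => _; lra.
have [hm|hm] := leP (mart w) a.
  by rewrite (asboolT (h w sw fw H1 hm)); lra.
have : 1 <= expR (mu * mart w) * expR (- (mu * a)).
  rewrite -expRD -expR0 ler_expR -mulrBr mulr_ge0 ?(ltW mu0) //.
  by rewrite subr_ge0 ltW.
by case: ifP => _; lra.
Qed.

Lemma feasible_take w i : feasible Ssa pol s1 w -> feasible Ssa pol s1 (take i w).
Proof.
rewrite /feasible; elim: w i [::] => [|s w IH] [|i] pre //= [h1 h2].
by split=> //; exact: IH.
Qed.

Lemma feasible_nth w i : feasible Ssa pol s1 w -> (i < size w)%N ->
  nth s1 w i \in Ssa (last s1 (take i w)) (pol s1 (take i w)).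
Proof.
rewrite /feasible -[take i w]cat0s; elim: w i [::] => [|s w IH] [|i] pre //= [h1 h2] hi.
  by rewrite cats0.
by rewrite -cat_rcons; exact: IH.
Qed.

End TrajectoryTree.

(** * The algorithm along a trajectory *)

Section Algorithm.
Variables (R : realType) (S A : finType) (d : nat).
Variables (Ssa : S -> A -> {set S}) (phi : S -> A -> S -> 'cV[R]_d).
Variables (r : S -> A -> R) (gamma lambda eta delta Ltheta Lphi : R) (N : nat).
Variables (f0 : R -> R -> R) (argsel : (A -> R) -> A) (a0 : A) (s1 : S).
Variable ths : 'cV[R]_d.
Hypothesis Ssa0 : forall s a, exists s', s' \in Ssa s a.
Hypothesis gamma01 : 0 <= gamma < 1.
Hypothesis r01 : forall s a, 0 <= r s a <= 1.
Hypothesis argselP : forall (f : A -> R) (a : A), f a <= f (argsel f).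
Implicit Types (rest w : seq S) (s : S) (a : A).

Local Notation st := (alg_state Ssa phi r gamma lambda eta delta Ltheta Lphi N f0 argsel a0 s1).
Local Notation pol := (fun s rest => ucmnlk Ssa phi r gamma lambda eta delta Ltheta Lphi N f0 argsel a0 s rest).
Local Notation act rest := (ucmnlk Ssa phi r gamma lambda eta delta Ltheta Lphi N f0 argsel a0 s1 rest).
Local Notation p := (pmnl Ssa phi ths).
Local Notation Vmax := ((1 - gamma)^-1).
Local Notation Vp := (Vpi Ssa phi r gamma ths pol).
Local Notation bet := (beta d Ssa delta Ltheta Lphi f0).
Local Notation stp := (step Ssa phi r gamma eta delta Ltheta Lphi N f0 argsel a0).

Lemma alg_state_rcons rest s' : st (rcons rest s') = stp (st rest) (last s1 rest) s'.
Proof.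
rewrite /alg_state; move: (init_state _ _ _ _ _ _ _ _ _ _ _ _) => x.
by elim: rest s1 x => [|y rest IH] s x //=.
Qed.

Lemma time_step x s s' : time (stp x s s') = (time x).+1.
Proof. by rewrite /step; case: ifP. Qed.

Lemma Sigma_step x s s' : Sigma (stp x s s') =
  Sigma x + hess (loss Ssa phi s (pi_k x s) s') (th_hat (stp x s s')).
Proof. by rewrite /step; case: ifP. Qed.

Lemma det_k_step x s s' : det_k (stp x s s') =
  if \det (Sigma (stp x s s')) <= 2 * det_k x then det_k x else \det (Sigma (stp x s s')).
Proof. by rewrite /step; case: ifP => /= ->. Qed.

Lemma pi_k_step x s s' : let x' := stp x s s' in
  pi_k x' = if \det (Sigma x') <= 2 * det_k x then pi_k x else
     episode_policy Ssa phi r gamma delta Ltheta Lphi N f0 argsel a0 (th_hat x') (Sigma x') (time x').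
Proof. by rewrite /= /step; case: ifP => /= ->. Qed.

Lemma Theta_step x s s' : 0 <= Ltheta -> Theta Ltheta (th_hat (stp x s s')).
Proof.
move=> L0; have T0 : Theta Ltheta (0 : 'cV[R]_d) by rewrite /Theta /= norm2E wnorm0.
(* If there is no minimiser, [xget] returns the default 0, which lies in [Theta] as well. *)
by rewrite /step; case: ifP => _ /=; case: xgetP => // y _ [].
Qed.

Lemma time_alg rest : time (st rest) = (size rest).+1.
Proof.
elim/last_ind: rest => // rest s' IH.
by rewrite alg_state_rcons time_step IH size_rcons.
Qed.

Lemma Theta_alg rest : 0 <= Ltheta -> Theta Ltheta (th_hat (st rest)).
Proof.
move=> L0; elim/last_ind: rest => [|rest s' IH].
  by rewrite /Theta /= norm2E wnorm0.
by rewrite alg_state_rcons; exact: Theta_step.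
Qed.

Lemma Sigma_alg rest s' : Sigma (st (rcons rest s')) =
  Sigma (st rest) + hess (loss Ssa phi (last s1 rest) (act rest) s') (th_hat (st (rcons rest s'))).
Proof. by rewrite alg_state_rcons Sigma_step. Qed.

Definition same_episode rest s' := \det (Sigma (st (rcons rest s'))) <= 2 * det_k (st rest).

(** The state of the algorithm keeps the policy and the determinant of its episode, but not the
    estimate and matrix behind them. The fold recovers the state at the start of the episode; its
    second component is the prefix read so far. *)
Definition episode_state rest : astate R S A d :=
  (foldl (fun x s' => (if same_episode x.2 s' then x.1 else st (rcons x.2 s'), rcons x.2 s'))
    (st [::], [::]) rest).1.

Lemma episode_state_rcons rest s' :
  episode_state (rcons rest s') = if same_episode rest s' then episode_state rest else st (rcons rest s').
Proof.
rewrite /episode_state foldl_rcons /=.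
suff -> : (foldl (fun x s' => (if same_episode x.2 s' then x.1 else st (rcons x.2 s'), rcons x.2 s'))
    (st [::], [::]) rest).2 = rest by [].
by elim/last_ind: rest => // rest y IH; rewrite foldl_rcons /= IH.
Qed.

Lemma episode_policyE rest : let x := episode_state rest in
  pi_k (st rest) = episode_policy Ssa phi r gamma delta Ltheta Lphi N f0 argsel a0 (th_hat x) (Sigma x) (time x).
Proof.
elim/last_ind: rest => //= rest s' IH.
rewrite episode_state_rcons alg_state_rcons pi_k_step -alg_state_rcons /same_episode IH.
by case: ifP.
Qed.

Lemma episode_detE rest : det_k (st rest) = \det (Sigma (episode_state rest)).
Proof.
elim/last_ind: rest => //= rest s' IH.
rewrite episode_state_rcons alg_state_rcons det_k_step -alg_state_rcons /same_episode IH.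
by case: ifP.
Qed.

Lemma episode_start rest : exists2 j, (j <= size rest)%N & episode_state rest = st (take j rest).
Proof.
elim/last_ind: rest => [|rest s' [j hj IH]]; first by exists 0%N.
rewrite episode_state_rcons; case: ifP => _.
  exists j; first by rewrite size_rcons ltnW.
  by rewrite IH -cats1 takel_cat.
by exists (size (rcons rest s')) => //; rewrite take_size.
Qed.

(** Either the last step passed the doubling test, or it opened an episode and the two matrices
    coincide. *)
Lemma episode_det_le rest : 0 <= \det (Sigma (st rest)) ->
  \det (Sigma (st rest)) <= 2 * \det (Sigma (episode_state rest)).
Proof.
case/lastP: rest => [|rest s'] h0.
  by rewrite /episode_state /=; rewrite ler_peMl // ler1n.
rewrite episode_state_rcons; case: ifP => [|_]; last by rewrite ler_peMl // ler1n.
by rewrite /same_episode episode_detE.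
Qed.

Definition conf_set rest : (S -> A -> S -> R) -> Prop :=
  let x := episode_state rest in polytope Ssa phi delta Ltheta Lphi f0 (th_hat x) (Sigma x) (time x).

Definition opt_value rest s : R := amax a0 (DEVI Ssa r gamma N a0 (conf_set rest) s).

Lemma conf_set_ge0 rest q : conf_set rest q -> forall s a s', 0 <= q s a s'.
Proof. by case=> h _ s a s'; case/andP: (h s a s'). Qed.
Lemma conf_set_sum rest q : conf_set rest q -> forall s a, \sum_(s' in Ssa s a) q s a s' = 1.
Proof. by case=> _ h s a; case: (h s a). Qed.

Lemma opt_value_bounds rest s : 0 <= opt_value rest s <= Vmax.
Proof. by apply: V_bounds => //; [exact: conf_set_ge0|exact: conf_set_sum]. Qed.

Lemma opt_value_greedy rest :
  opt_value rest (last s1 rest) = DEVI Ssa r gamma N a0 (conf_set rest) (last s1 rest) (act rest).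
Proof.
rewrite /ucmnlk episode_policyE /episode_policy -/(conf_set rest) /opt_value.
apply/le_anti/andP; split; last exact: le_amax.
by apply: amax_le => a; exact: argselP.
Qed.

(** The optimistic value is the one fixed before the transition to [s']. This gives [noise] mean
    zero; a change of episode caused by the transition is charged separately. *)
Definition gap rest s' : R := opt_value rest s' - Vp s1 (rcons rest s').
Definition noise rest s' : R :=
  \sum_s'' p (last s1 rest) (act rest) s'' * gap rest s'' - gap rest s'.

Lemma gap_norm rest s' : `|gap rest s'| <= Vmax.
Proof.
have /andP[h0 h1] := opt_value_bounds rest s'.
have := Vpi_ge0 phi ths Ssa0 gamma01 r01 pol s1 (rcons rest s').
have := Vpi_le phi ths Ssa0 gamma01 r01 pol s1 (rcons rest s').
by rewrite /gap ler_norml => h2 h3; lra.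
Qed.

Lemma noise_mean rest : \sum_s' p (last s1 rest) (act rest) s' * noise rest s' = 0.
Proof.
rewrite /noise; under eq_bigr => s' _ do rewrite mulrBr.
by rewrite sumrB -mulr_suml pmnl_sum_all // mul1r subrr.
Qed.

Lemma noise_norm rest s' : `|noise rest s'| <= 2 * Vmax.
Proof.
rewrite /noise; apply: le_trans (ler_normB _ _) _.
rewrite mulr_natl mulr2n; apply: lerD; last exact: gap_norm.
have h x : - Vmax <= gap rest x <= Vmax by rewrite -ler_norml gap_norm.
rewrite ler_norml; apply/andP; split.
  by apply: pmnl_mean_ge => // x; case/andP: (h x).
by apply: pmnl_mean_le => // x; case/andP: (h x).
Qed.

(** Subtract the Bellman equation of the policy from [Q_upper] at the greedy action. The mean of the
    next gap is split into its realised value and [noise]; a new episode changes the optimistic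
    value by at most [Vmax]. *)
Lemma one_step_gap rest s' rho : (0 < N)%N ->
  conf_set rest p ->
  (forall q, conf_set rest q -> \sum_(x in Ssa (last s1 rest) (act rest))
      `|q (last s1 rest) (act rest) x - p (last s1 rest) (act rest) x| <= rho) ->
  opt_value rest (last s1 rest) - Vp s1 rest <=
    gamma * rho * Vmax + gamma ^+ N +
    gamma * (noise rest s' + (opt_value (rcons rest s') s' - Vp s1 (rcons rest s'))
             + (~~ same_episode rest s')%:R * Vmax).
Proof.
move=> N0 hp hrho; have g0 : 0 <= gamma by case/andP: gamma01.
have hchg : opt_value rest s' <= opt_value (rcons rest s') s' + (~~ same_episode rest s')%:R * Vmax.
  have /andP[h1 _] := opt_value_bounds (rcons rest s') s'.
  have /andP[_ h2] := opt_value_bounds rest s'.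
  have [sm|sm] := boolP (same_episode rest s'); last by rewrite mul1r; lra.
  by rewrite mul0r addr0 /opt_value /conf_set episode_state_rcons sm.
have := Q_upper a0 Ssa0 gamma01 r01 (@conf_set_ge0 rest) (@conf_set_sum rest) hp N.-1 hrho.
rewrite prednK // -/(DEVI Ssa r gamma N a0 (conf_set rest)) -opt_value_greedy => Q.
rewrite (Vpi_bellman phi ths Ssa0 gamma01 r01) /=.
have -> : noise rest s' = \sum_s'' p (last s1 rest) (act rest) s'' * opt_value rest s''
   - \sum_s'' p (last s1 rest) (act rest) s'' * Vp s1 (rcons rest s'')
   - (opt_value rest s' - Vp s1 (rcons rest s')).
  by rewrite /noise -sumrB; congr (_ - _); apply: eq_bigr => x _; rewrite -mulrBr.
have := ler_wpM2l g0 hchg; rewrite -/(opt_value rest _) in Q *; move: Q.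
rewrite -/(opt_value rest); lra.
Qed.

(** Summing [one_step_gap] puts [gamma] times the shifted sum of gaps on the right; as gaps are
    nonnegative, the shifted sum is at most the full one and is absorbed on the left, leaving
    [1 - gamma]. *)
Lemma regret_decomposition T w (rho : nat -> R) : (0 < N)%N -> (size w).+1 = T ->
  (forall i, (i < T)%N -> conf_set (take i w) p) ->
  (forall i q, (i < size w)%N -> conf_set (take i w) q ->
     \sum_(x in Ssa (last s1 (take i w)) (act (take i w)))
      `|q (last s1 (take i w)) (act (take i w)) x - p (last s1 (take i w)) (act (take i w)) x| <= rho i) ->
  (1 - gamma) * regret Ssa phi r gamma ths pol T s1 w <=
    Vmax + \sum_(i < size w) (gamma * rho i * Vmax + gamma ^+ N) + gamma * mart s1 noise w
    + gamma * (Vmax * \sum_(i < size w) (~~ same_episode (take i w) (nth s1 w i))%:R).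
Proof.
move=> N0 eT hp hrho; have g0 : 0 <= gamma by case/andP: gamma01.
have g1 : gamma < 1 by case/andP: gamma01.
pose D i := opt_value (take i w) (last s1 (take i w)) - Vp s1 (take i w).
have D0 i : (i < T)%N -> 0 <= D i.
  move=> iT; rewrite subr_ge0; apply: optimism_Vpi => //; [exact: conf_set_ge0|exact: conf_set_sum|exact: hp].
have DM i : D i <= Vmax.
  have /andP[_ h1] := opt_value_bounds (take i w) (last s1 (take i w)).
  have := Vpi_ge0 phi ths Ssa0 gamma01 r01 pol s1 (take i w); rewrite /D; lra.
have hreg : regret Ssa phi r gamma ths pol T s1 w <= \sum_(i < T) D i.
  apply: ler_sum => i _; rewrite lerD2r; apply: optimism_Vstar => //; [exact: conf_set_ge0|exact: conf_set_sum|exact: hp].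
apply: (@le_trans _ _ ((1 - gamma) * \sum_(i < T) D i)).
  by rewrite ler_wpM2l // subr_ge0 ltW.
rewrite mulrBl mul1r lerBlDr.
(* A trajectory of [T] states has [T - 1] observed transitions, so the last gap is bounded by [Vmax]
   alone. *)
have e1 : \sum_(i < T) D i = \sum_(i < size w) D i + D (size w).
  by rewrite -eT big_ord_recr.
have e2 : \sum_(i < size w) D i.+1 <= \sum_(i < T) D i.
  by rewrite -eT big_ord_recl /= lerDr D0 // -eT.
have h : \sum_(i < size w) D i <= \sum_(i < size w) ((gamma * rho i * Vmax + gamma ^+ N) +
   gamma * (noise (take i w) (nth s1 w i) + D i.+1 + (~~ same_episode (take i w) (nth s1 w i))%:R * Vmax)).
  apply: ler_sum => i _; have hi := ltn_ord i.
  have iT : (i < T)%N by rewrite -eT ltnS ltnW.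
  have el : last s1 (take i.+1 w) = nth s1 w i by rewrite (take_nth s1) // last_rcons.
  have := @one_step_gap (take i w) (nth s1 w i) (rho i) N0 (hp i iT) (fun q => hrho i q hi).
  by rewrite -take_nth // /D el.
have e3 : \sum_(i < size w) ((gamma * rho i * Vmax + gamma ^+ N) +
   gamma * (noise (take i w) (nth s1 w i) + D i.+1 + (~~ same_episode (take i w) (nth s1 w i))%:R * Vmax)) =
  \sum_(i < size w) (gamma * rho i * Vmax + gamma ^+ N) + gamma * (mart s1 noise w +
    \sum_(i < size w) D i.+1 + Vmax * \sum_(i < size w) (~~ same_episode (take i w) (nth s1 w i))%:R).
  clearbody D; rewrite big_split /=; congr (_ + _).
  by rewrite /mart [Vmax * _]mulrC mulr_suml -!big_split /= mulr_sumr.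
rewrite e3 in h; have := ler_wpM2l g0 e2; have := DM (size w).
move: h e1; move: (\sum_(i < T) _) (\sum_(i < size w) D i) (\sum_(i < size w) D i.+1) (\sum_(i < size w) (_ + _)).
by move: (\sum_(i < size w) _) => *; nra.
Qed.

End Algorithm.

Lemma norm_outer_entry (R : realType) (d : nat) (v : 'cV[R]_d) i j :
  `|(v *m v^T) i j| <= dotv v v.
Proof.
have -> : dotv v v = \sum_l v l 0 ^+ 2.
  by rewrite /dotv mxE; apply: eq_bigr => l _; rewrite mxE expr2.
rewrite mxE big_ord1 [v^T _ _]mxE.
have vl l : v l 0 ^+ 2 <= \sum_l v l 0 ^+ 2.
  by rewrite (bigD1 l) //= lerDl; apply: sumr_ge0 => k' _; rewrite sqr_ge0.
have := vl i; have := vl j; rewrite ler_norml => h1 h2.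
have := sqr_ge0 (v i 0 - v j 0); have := sqr_ge0 (v i 0 + v j 0).
rewrite !expr2 in h1 h2 *; nra.
Qed.

(** * Confidence radii and information gain along one trajectory *)

Section Trajectory.
Variables (R : realType) (S A : finType) (d : nat).
Variables (Ssa : S -> A -> {set S}) (phi : S -> A -> S -> 'cV[R]_d).
Variables (r : S -> A -> R) (gamma lambda eta delta Ltheta Lphi : R) (N : nat).
Variables (f0 : R -> R -> R) (argsel : (A -> R) -> A) (a0 : A) (s1 : S).
Variable ths : 'cV[R]_d.
Hypothesis Ssa0 : forall s a, exists s', s' \in Ssa s a.
Local Notation st := (alg_state Ssa phi r gamma lambda eta delta Ltheta Lphi N f0 argsel a0 s1).
Local Notation pol := (fun s rest => ucmnlk Ssa phi r gamma lambda eta delta Ltheta Lphi N f0 argsel a0 s rest).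
Local Notation act rest := (ucmnlk Ssa phi r gamma lambda eta delta Ltheta Lphi N f0 argsel a0 s1 rest).
Local Notation p := (pmnl Ssa phi).
Local Notation bet := (beta d Ssa delta Ltheta Lphi f0).
Local Notation episode := (episode_state Ssa phi r gamma lambda eta delta Ltheta Lphi N f0 argsel a0 s1).
Local Notation conf := (conf_set Ssa phi r gamma lambda eta delta Ltheta Lphi N f0 argsel a0 s1).
Local Notation same := (same_episode Ssa phi r gamma lambda eta delta Ltheta Lphi N f0 argsel a0 s1).
Implicit Types (th : 'cV[R]_d) (s : S) (a : A) (M : 'M[R]_d).

Lemma sqr_wnorm_le_bigmax M s a j : j \in Ssa s a ->
  wnorm M (phi s a j) ^+ 2 <= \big[Num.max/0]_(k in Ssa s a) wnorm M (phi s a k) ^+ 2.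
Proof. by move=> hj; apply: le_bigmax_cond. Qed.

Lemma bigmax_sqr_ge0 M s a : 0 <= \big[Num.max/0]_(k in Ssa s a) wnorm M (phi s a k) ^+ 2.
Proof. exact: bigmax_ge_id. Qed.

Lemma wnorm_le_sqrt_bigmax M s a j : j \in Ssa s a ->
  wnorm M (phi s a j) <= Num.sqrt (\big[Num.max/0]_(k in Ssa s a) wnorm M (phi s a k) ^+ 2).
Proof.
move=> hj; rewrite -(ger0_norm (wnorm_ge0 _ _)) -sqrtr_sqr ler_wsqrtr //.
exact: sqr_wnorm_le_bigmax.
Qed.

Lemma dotv_dev th s a j (D : 'cV[R]_d) :
  dotv (phi s a j - mean (Ssa s a) (phi s a) (p th s a)) D =
  dotv (phi s a j) D - \sum_(k in Ssa s a) p th s a k * dotv (phi s a k) D.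
Proof.
rewrite dotvC {1}/dotv mulmxBr mxE [X in _ + X]mxE -!/(dotv _ _) dotvC; congr (_ - _).
rewrite /mean /dotv mulmx_sumr summxE; apply: eq_bigr => k _.
by rewrite -scalemxAr mxE -/(dotv _ _) dotvC.
Qed.

Lemma pmnl_tv_inner th th' s a (m : R) :
  (forall j, j \in Ssa s a -> `|dotv (phi s a j) (th' - th)| <= m) ->
  \sum_(j in Ssa s a) `|p th' s a j - p th s a j| <=
  \sum_(j in Ssa s a) p th s a j * `|dotv (phi s a j - mean (Ssa s a) (phi s a) (p th s a)) (th' - th)| + 3 * m ^+ 2.
Proof.
move=> hm.
have := @tilt_tv R S (Ssa s a) (p th s a) (p th' s a) (fun j => dotv (phi s a j) (th' - th)) m.
move=> /(_ (fun j _ => pmnl_ge0 phi Ssa0 th s a j) (pmnl_sum phi Ssa0 th s a) (fun j hj => pmnl_tilt phi Ssa0 th th' hj) hm).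
by under [X in _ <= X + _ -> _]eq_bigr => j _ do rewrite -dotv_dev.
Qed.

(** For [m < 1] the refined bound is [2 * m + 3 * m ^+ 2]; otherwise the trivial bound 2 suffices. A
    linear estimate is enough where another small factor multiplies it. *)
Lemma pmnl_tv_coarse th th' s a (m : R) : 0 <= m ->
  (forall j, j \in Ssa s a -> `|dotv (phi s a j) (th' - th)| <= m) ->
  \sum_(j in Ssa s a) `|p th' s a j - p th s a j| <= 5 * m.
Proof.
move=> m0 hm.
have [m1|m1] := leP 1 m.
  apply: (@le_trans _ _ (\sum_(j in Ssa s a) (p th' s a j + p th s a j))).
    apply: ler_sum => j _; apply: le_trans (ler_normB _ _) _.
    by rewrite !ger0_norm ?pmnl_ge0.
  rewrite big_split /= !pmnl_sum //; lra.
apply: le_trans (pmnl_tv_inner hm) _.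
have : \sum_(j in Ssa s a) p th s a j * `|dotv (phi s a j - mean (Ssa s a) (phi s a) (p th s a)) (th' - th)| <= 2 * m.
  apply: (@le_trans _ _ (\sum_(j in Ssa s a) p th s a j * (2 * m))); last by rewrite -mulr_suml pmnl_sum // mul1r.
  apply: ler_sum => j hj; rewrite ler_wpM2l ?pmnl_ge0 // dotv_dev.
  apply: le_trans (ler_normB _ _) _; rewrite mulr_natl mulr2n; apply: lerD; first exact: hm.
  apply: xbar_le hm => [k _|]; [exact: pmnl_ge0|exact: pmnl_sum].
nra.
Qed.

(** The two terms of the polytope radius are those of [pmnl_tv_inner] after Cauchy-Schwarz in the
    norm of [Sg]. *)
Lemma polytope_contains th (Sg : 'M[R]_d) t : pdm Sg -> wnorm Sg (th - ths) <= bet t ->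
  polytope Ssa phi delta Ltheta Lphi f0 th Sg t (p ths).
Proof.
move=> pS hb; have b0 : 0 <= bet t by apply: le_trans hb; exact: wnorm_ge0.
have hd (x : 'cV[R]_d) : `|dotv x (ths - th)| <= bet t * wnorm (invmx Sg) x.
  apply: le_trans (dotv_wnorm _ _ pS) _; rewrite mulrC ler_wpM2r ?wnorm_ge0 //.
  by rewrite -wnormN opprB.
split=> [s a s'|s a]; first by rewrite pmnl_ge0 // pmnl_le1.
split; first exact: pmnl_sum.
set m2 := \big[Num.max/0]_(_ in _) _.
have m20 : 0 <= m2 by exact: bigmax_sqr_ge0.
apply: le_trans (@pmnl_tv_inner th ths s a (bet t * Num.sqrt m2) _) _.
  move=> j hj; apply: le_trans (hd _) _; rewrite ler_wpM2l //.
  exact: wnorm_le_sqrt_bigmax.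
rewrite exprMn sqr_sqrtr // mulrA lerD2r mulr_sumr; apply: ler_sum => j hj.
by rewrite mulrCA ler_wpM2l ?pmnl_ge0 //; exact: hd.
Qed.

Lemma polytope_diameter th (Sg : 'M[R]_d) t s a q : 
  polytope Ssa phi delta Ltheta Lphi f0 th Sg t (p ths) ->
  polytope Ssa phi delta Ltheta Lphi f0 th Sg t q ->
  \sum_(j in Ssa s a) `|q s a j - p ths s a j| <=
   2 * (bet t * dev (Ssa s a) (invmx Sg) (phi s a) (p th s a) +
        3 * bet t ^+ 2 * \big[Num.max/0]_(k in Ssa s a) wnorm (invmx Sg) (phi s a k) ^+ 2).
Proof.
move=> [_ /(_ s a) [_ h1]] [_ /(_ s a) [_ h2]].
rewrite mulr_natl mulr2n; apply: le_trans (lerD h2 h1).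
rewrite -big_split /=; apply: ler_sum => j _.
rewrite [X in _ <= _ + X]distrC; apply: le_trans (ler_normD _ _).
by rewrite addrA subrK.
Qed.

Hypothesis Ltheta0 : 0 <= Ltheta.
Variable w : seq S.
Hypothesis wfeas : feasible Ssa pol s1 w.
Let n := size w.
Local Notation G i := (Sigma (st (take i w))).
Local Notation th i := (th_hat (st (take i w))).
Local Notation s_ i := (last s1 (take i w)).
Local Notation a_ i := (act (take i w)).

Lemma Sigma_next i : (i < n)%N ->
  G i.+1 = addouter (G i) (hvecs Ssa phi (th i.+1) (s_ i) (a_ i)).
Proof.
move=> hi; rewrite {1}(take_nth s1 hi) Sigma_alg -(take_nth s1 hi).
by apply: hess_addouter => //; exact: (feasible_nth wfeas hi).
Qed.

Lemma Sigma_mono i j : (i <= j)%N -> (j <= n)%N -> exists ws, G j = addouter (G i) ws.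
Proof.
move=> /subnK <-; elim: (j - i)%N => [|k IH] hk.
  by exists [::]; rewrite addouter0.
have [|ws e] := IH; first exact: ltnW.
by rewrite addSn Sigma_next // e addouter_cat; eexists.
Qed.

Lemma Sigma0 : G 0 = lambda%:M. Proof. by rewrite take0. Qed.

Lemma episode_take i : exists2 j, (j <= i)%N & episode (take i w) = st (take j w).
Proof.
have [j hj ->] := episode_start Ssa phi r gamma lambda eta delta Ltheta Lphi N f0 argsel a0 s1 (take i w).
exists (minn j i); first exact: geq_minr.
by rewrite -take_min.
Qed.

Section Nondegenerate.
Hypothesis lambda0 : 0 < lambda.
Hypothesis lambdaL : 4 * Lphi ^+ 2 <= lambda.
Hypothesis phiL : forall s a s', norm2 (phi s a s') <= Lphi.

Lemma pdm_Sigma i : (i <= n)%N -> pdm (G i).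
Proof.
move=> hi; have [ws ->] := Sigma_mono (leq0n i) hi.
by apply: pdm_addouter; rewrite Sigma0; exact: pdm_scalar.
Qed.

Lemma det_Sigma_mono i j : (i <= j)%N -> (j <= n)%N -> \det (G i) <= \det (G j).
Proof.
move=> hij hj; have [ws ->] := Sigma_mono hij hj.
by apply: det_addouter_le; apply: pdm_Sigma; exact: leq_trans hj.
Qed.

Lemma dev_norm_le th s a j : dotv (phi s a j - mean (Ssa s a) (phi s a) (p th s a))
   (phi s a j - mean (Ssa s a) (phi s a) (p th s a)) <= lambda.
Proof.
rewrite dotv_bil -/(qf _ _) -wnorm_sqr; last exact: psd1.
apply: le_trans lambdaL.
have h k : wnorm 1%:M (phi s a k) <= Lphi by rewrite -norm2E.
have hm := wnorm_mean_le (psd1 R d) (fun j _ => pmnl_ge0 phi Ssa0 th s a j) (pmnl_sum phi Ssa0 th s a) (fun k _ => h k).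
have hB := wnormB (phi s a j) (mean (Ssa s a) (phi s a) (p th s a)) (psd1 R d).
have := h j; have := wnorm_ge0 1%:M (phi s a j - mean (Ssa s a) (phi s a) (p th s a)).
nra.
Qed.

(** The trace of [invmx (G i)] times the Hessian that leads to [G i.+1]. Indices start at 0, so
    [G i] is the matrix at time [i + 1]. *)
Definition info i := \sum_(j in Ssa (s_ i) (a_ i)) p (th i.+1) (s_ i) (a_ i) j *
  qf (invmx (G i)) (phi (s_ i) (a_ i) j - mean (Ssa (s_ i) (a_ i)) (phi (s_ i) (a_ i)) (p (th i.+1) (s_ i) (a_ i))).

Lemma info_bounds i : (i < n)%N -> 0 <= info i <= 1.
Proof.
move=> hi; have pG := pdm_Sigma (ltnW hi).
apply/andP; split.
  by apply: sumr_ge0 => j _; rewrite mulr_ge0 ?pmnl_ge0 //; exact: (psd_invmx pG).2.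
rewrite /info -[leRHS](pmnl_sum phi Ssa0 (th i.+1) (s_ i) (a_ i)).
apply: ler_sum => j _; rewrite ler_piMr ?pmnl_ge0 //.
have [ws ->] := Sigma_mono (leq0n i) (ltnW hi).
apply: le_trans (qf_inv_addouter _ _ _) _; first by rewrite Sigma0; exact: pdm_scalar.
rewrite Sigma0 qf_inv_scalar mulrC ler_pdivrMr // mul1r; exact: dev_norm_le.
Qed.

Lemma info_ln i : (i < n)%N -> info i / 2 <= ln (\det (G i.+1)) - ln (\det (G i)).
Proof.
move=> hi; have pG := pdm_Sigma (ltnW hi).
have := det_addouter (hvecs Ssa phi (th i.+1) (s_ i) (a_ i)) pG.
rewrite -Sigma_next // qf_hvecs // -/(info i) => h.
have /andP[i0 i1] := info_bounds hi.
apply: le_trans (ln_ge_half (info_bounds hi)) _.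
rewrite lerBrDl -lnM ?posrE ?pG.2 ?ler_ln ?posrE //; last lra.
- by rewrite mulr_gt0 ?pG.2 //; lra.
- exact: (pdm_Sigma hi).2.
Qed.

Lemma info_sum m : (m <= n)%N -> \sum_(i < m) info i <= 2 * (ln (\det (G m)) - ln (\det (G 0))).
Proof.
elim: m => [|m IH] hm; first by rewrite big_ord0 subrr mulr0.
rewrite big_ord_recr /=; have := IH (ltnW hm); have := info_ln hm; lra.
Qed.

(** Each Hessian is a convex combination of outer products whose entries are at most the squared
    deviation norm, hence at most [lambda]. *)
Lemma Sigma_entry m i j : (m <= n)%N -> `|G m i j| <= lambda * m.+1%:R.
Proof.
elim: m => [|m IH] hm.
  rewrite Sigma0 mxE mulr1; case: eqP => _; first by rewrite mulr1n gtr0_norm.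
  by rewrite mulr0n normr0 ltW.
rewrite Sigma_next // /addouter mxE; apply: le_trans (ler_normD _ _) _.
rewrite -natr1 mulrDr mulr1; apply: lerD; first exact: IH (ltnW hm).
rewrite /hvecs big_map big_enum /= summxE; apply: le_trans (ler_norm_sum _ _ _) _.
rewrite -[leRHS]mul1r -(pmnl_sum phi Ssa0 (th m.+1) (s_ m) (a_ m)) mulr_suml.
apply: ler_sum => k _.
rewrite linearZ /= -scalemxAl -scalemxAr scalerA -expr2 sqr_sqrtr ?pmnl_ge0 // mxE.
rewrite normrM ger0_norm ?pmnl_ge0 // ler_wpM2l ?pmnl_ge0 //.
by apply: le_trans (norm_outer_entry _ _ _) _; exact: dev_norm_le.
Qed.

(** The power of [lambda] in the determinant bound cancels against the determinant of the initial
    matrix, so the result is free of [lambda]. *)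
Lemma ln_det_Sigma : (0 < d)%N ->
  ln (\det (G n)) - ln (\det (G 0)) <= d%:R * ln (d%:R * n.+1%:R).
Proof.
move=> d0; have dG := (pdm_Sigma (leqnn n)).2.
have h := norm_det_le (fun i j => Sigma_entry i j (leqnn n)).
rewrite (gtr0_norm dG) in h.
have fact_le m : (m`! <= m ^ m)%N.
  elim: m => // m IH; rewrite factS expnS leq_mul2l /=.
  by apply: leq_trans IH _; case: m => // m; rewrite leq_exp2r.
rewrite Sigma0 det_scalar lerBlDr.
have -> : d%:R * ln (d%:R * n.+1%:R) = ln ((d%:R * n.+1%:R) ^+ d) :> R.
  by rewrite lnXn ?mulr_gt0 ?ltr0n // mulr_natl.
rewrite -lnM ?posrE ?exprn_gt0 ?mulr_gt0 ?ltr0n // ler_ln ?posrE //; last first.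
  by rewrite mulr_gt0 ?exprn_gt0 ?mulr_gt0 ?ltr0n.
apply: le_trans h _; rewrite !exprMn mulrCA [leRHS]mulrC.
rewrite ler_wpM2l ?exprn_ge0 ?(ltW lambda0) //.
rewrite ler_wpM2r ?exprn_ge0 ?ler0n // -natrX ler_nat; exact: fact_le.
Qed.

(** A new episode opens only when the determinant exceeds twice that of the previous episode start,
    so each one adds at least [ln 2]. *)
Lemma episode_count m : (m <= n)%N ->
  ln 2 * (\sum_(i < m) (~~ same (take i w) (nth s1 w i))%:R) + ln (\det (G 0))
    <= ln (\det (Sigma (episode (take m w)))).
Proof.
elim: m => [|m IH] hm.
  by rewrite big_ord0 mulr0 add0r take0.
rewrite big_ord_recr /= (take_nth s1 hm) episode_state_rcons.
have := IH (ltnW hm); case: (boolP (same _ _)) => /= sm h; first by rewrite addr0.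
rewrite mulrDr mulr1 addrAC; apply: le_trans (lerD h (lexx _)) _.
have [j hj ej] := episode_take m.
have pj := pdm_Sigma (leq_trans hj (ltnW hm)).
rewrite -(take_nth s1 hm) ej addrC -lnM ?posrE ?pj.2 // ler_ln ?posrE ?mulr_gt0 ?pj.2 //; last exact: (pdm_Sigma hm).2.
move: sm; rewrite /same_episode -ltNge -(take_nth s1 hm) episode_detE ej => /ltW; exact.
Qed.

Lemma episode_count_le : (0 < d)%N ->
  \sum_(i < n) (~~ same (take i w) (nth s1 w i))%:R <= 2 * d%:R * ln (d%:R * n.+1%:R) :> R.
Proof.
move=> d0; have h := episode_count (leqnn n).
have [j hj ej] := episode_take n.
have hd : ln (\det (Sigma (episode (take n w)))) <= ln (\det (G n)).
  rewrite ej ler_ln ?posrE ?det_Sigma_mono //; apply: (pdm_Sigma _).2 => //.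
have := ln_det_Sigma d0; have := ln2_ge_half R.
have : 0 <= \sum_(i < n) (~~ same (take i w) (nth s1 w i))%:R :> R by apply: sumr_ge0 => i _; exact: ler0n.
nra.
Qed.

Variables (kappa B : R).
Hypothesis kappa0 : 0 < kappa.
Hypothesis info_lower : forall i, (i < n)%N -> forall th0, Theta Ltheta th0 ->
  forall s' s'', s' \in Ssa (s_ i) (a_ i) -> s'' \in Ssa (s_ i) (a_ i) ->
  kappa <= p th0 (s_ i) (a_ i) s' * p th0 (s_ i) (a_ i) s''.
Hypothesis phi_zero : forall s a, exists2 s', s' \in Ssa s a & phi s a s' = 0.
Hypothesis confident : forall i, (i <= n)%N -> wnorm (G i) (th i - ths) <= bet i.+1.
Hypothesis betB : forall i, (i <= n)%N -> bet i.+1 <= B.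

Lemma conf_set_star i : (i <= n)%N -> conf (take i w) (p ths).
Proof.
move=> hi; have [j hj ej] := episode_take i.
have jn := leq_trans hj hi.
rewrite /conf_set /= ej time_alg size_takel //.
by apply: polytope_contains; [exact: pdm_Sigma|exact: confident].
Qed.

Lemma episode_doubling i j x : (j <= i)%N -> (i <= n)%N -> episode (take i w) = st (take j w) ->
  qf (invmx (G j)) x <= 2 * qf (invmx (G i)) x.
Proof.
move=> hj hi ej; have [ws e] := Sigma_mono hj hi.
rewrite e; apply: qf_inv_doubling; first exact: pdm_Sigma (leq_trans hj hi).
rewrite -e -ej; apply: episode_det_le; exact: ltW (pdm_Sigma hi).2.
Qed.

(** The source of [1 / kappa]: [var_ge_pair] for [k] and the zero-feature outcome, with (A2) at the
    updated estimate, which lies in [Theta]. The 2 is the price of the matrix from the episode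
    start. *)
Lemma bigmax_le_info i j : (j <= i)%N -> (i < n)%N -> episode (take i w) = st (take j w) ->
  \big[Num.max/0]_(k in Ssa (s_ i) (a_ i)) wnorm (invmx (G j)) (phi (s_ i) (a_ i) k) ^+ 2
    <= 2 / kappa * info i.
Proof.
move=> hj hi ej; have pG := pdm_Sigma (ltnW hi).
have /andP[i0 _] := info_bounds hi.
apply: bigmax_le => [|k hk]; first by rewrite mulr_ge0 ?divr_ge0 // ltW.
rewrite wnorm_sqr; last by apply: psd_invmx; exact: pdm_Sigma (leq_trans hj (ltnW hi)).
apply: le_trans (episode_doubling _ hj (ltnW hi) ej) _.
rewrite -mulrA ler_wpM2l // mulrC ler_pdivlMr // mulrC.
have [k0 hk0 fk0] := phi_zero (s_ i) (a_ i).
apply: le_trans (var_ge_pair (psd_invmx pG) hk hk0 fk0 (fun j _ => pmnl_ge0 phi Ssa0 (th i.+1) (s_ i) (a_ i) j) (pmnl_sum phi Ssa0 (th i.+1) (s_ i) (a_ i))).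
rewrite ler_wpM2r ?(psd_invmx pG).2 //; apply: info_lower => //.
exact: Theta_alg.
Qed.

(** The deviation at the planning estimate is moved to the updated one, where Jensen bounds it by
    the information gain. The cost of the move is second order: total variation of order [B] times a
    feature norm, times a feature norm. *)
Lemma dev_episode_le i j : (j <= i)%N -> (i < n)%N -> episode (take i w) = st (take j w) ->
  dev (Ssa (s_ i) (a_ i)) (invmx (G j)) (phi (s_ i) (a_ i)) (p (th j) (s_ i) (a_ i)) <=
  Num.sqrt (2 * info i) + 60 * B / kappa * info i.
Proof.
move=> hj hi ej; have jn := leq_trans hj (ltnW hi).
have pGj := pdm_Sigma jn; have pI := psd_invmx pGj.
have B0 : 0 <= B by apply: le_trans (betB (leq0n n)); apply: le_trans (confident (leq0n n)); exact: wnorm_ge0.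
set m2 := \big[Num.max/0]_(k in Ssa (s_ i) (a_ i)) wnorm (invmx (G j)) (phi (s_ i) (a_ i) k) ^+ 2.
have hm2 : m2 <= 2 / kappa * info i by exact: bigmax_le_info.
have m20 : 0 <= m2 by exact: bigmax_sqr_ge0.
have hm k : k \in Ssa (s_ i) (a_ i) -> wnorm (invmx (G j)) (phi (s_ i) (a_ i) k) <= Num.sqrt m2.
  by move=> hk; exact: wnorm_le_sqrt_bigmax.
(* The updated estimate is controlled in the norm of [G i.+1], which dominates that of [G j]. *)
have hth : wnorm (G j) (th j - th i.+1) <= 2 * B.
  rewrite (_ : th j - th i.+1 = (th j - ths) - (th i.+1 - ths)); last by rewrite opprB addrA subrK.
  apply: le_trans (wnormB _ _ pGj.1) _; rewrite mulr_natl mulr2n; apply: lerD.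
    by apply: le_trans (confident jn) _; exact: betB.
  have [ws e] := Sigma_mono (leq_trans hj (leqnSn i)) hi.
  apply: le_trans (wnorm_addouter _ ws _) _; rewrite -e.
  by apply: le_trans (confident hi) _; exact: betB.
have tv : \sum_(k in Ssa (s_ i) (a_ i)) `|p (th j) (s_ i) (a_ i) k - p (th i.+1) (s_ i) (a_ i) k| <= 5 * (2 * B * Num.sqrt m2).
  apply: pmnl_tv_coarse => [|k hk]; first by rewrite !mulr_ge0 ?sqrtr_ge0.
  apply: le_trans (dotv_wnorm _ _ pGj) _; rewrite mulrC.
  by apply: ler_pM => //; [exact: wnorm_ge0|exact: wnorm_ge0|exact: hm].
have := dev_le_tv pI (fun k _ => pmnl_ge0 phi Ssa0 (th j) (s_ i) (a_ i) k) (pmnl_sum phi Ssa0 (th j) (s_ i) (a_ i))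
  (fun k _ => pmnl_ge0 phi Ssa0 (th i.+1) (s_ i) (a_ i) k) (pmnl_sum phi Ssa0 (th i.+1) (s_ i) (a_ i)) hm tv.
move=> /le_trans; apply; apply: lerD.
  apply: le_trans (dev_sqr_le _ _ pI (fun k _ => pmnl_ge0 phi Ssa0 (th i.+1) (s_ i) (a_ i) k) (pmnl_sum phi Ssa0 (th i.+1) (s_ i) (a_ i))) _.
  rewrite ler_wsqrtr // mulr_sumr; apply: ler_sum => k _.
  rewrite mulrCA ler_wpM2l ?pmnl_ge0 //; exact: episode_doubling (ltnW hi) ej.
(* The 3 is from [dev_le_tv], the 5 from [pmnl_tv_coarse] and the 2 from [hth]; [hm2] then doubles
   30 to 60. *)
have -> : 3 * Num.sqrt m2 * (5 * (2 * B * Num.sqrt m2)) = 30 * B * m2.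
  by rewrite -[in RHS](sqr_sqrtr m20); ring.
apply: le_trans (ler_wpM2l _ hm2) _; first by rewrite mulr_ge0.
by rewrite le_eqVlt; apply/orP; left; apply/eqP; field; rewrite gt_eqF.
Qed.

(** The constant 132 is [2 * (60 + 3 * 2)]: 60 from [dev_episode_le], [3 * 2] from the second-order
    polytope term through [bigmax_le_info], and the outer 2 from the diameter. *)
Definition radius i := 2 * B * Num.sqrt (2 * info i) + 132 * B ^+ 2 / kappa * info i.

Lemma conf_set_radius i q : (i < n)%N -> conf (take i w) q ->
  \sum_(k in Ssa (s_ i) (a_ i)) `|q (s_ i) (a_ i) k - p ths (s_ i) (a_ i) k| <= radius i.
Proof.
move=> hi hq; have [j hj ej] := episode_take i.
have jn := leq_trans hj (ltnW hi).
have hp := conf_set_star (ltnW hi).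
rewrite /conf_set /= ej time_alg size_takel // in hp hq.
apply: le_trans (polytope_diameter _ _ hp hq) _.
have b0 : 0 <= bet j.+1 by apply: le_trans (confident jn); exact: wnorm_ge0.
have bB := betB jn; have B0 := le_trans b0 bB.
have hd := dev_episode_le hj hi ej; have hm := bigmax_le_info hj hi ej.
have m0 := bigmax_sqr_ge0 (invmx (G j)) (s_ i) (a_ i).
set D := dev _ _ _ _ in hd *; set m2 := \big[Num.max/0]_(_ in _) _ in hm m0 *.
have D0 : 0 <= D by apply: sumr_ge0 => k _; rewrite mulr_ge0 ?pmnl_ge0 ?wnorm_ge0.
have h1 : bet j.+1 * D <= B * (Num.sqrt (2 * info i) + 60 * B / kappa * info i) by apply: ler_pM.
have h2 : bet j.+1 ^+ 2 * m2 <= B ^+ 2 * (2 / kappa * info i).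
  by apply: ler_pM => //; [exact: sqr_ge0|rewrite lerXn2r ?nnegrE].
rewrite /radius; nra.
Qed.

Lemma radius_sum : (0 < d)%N -> (d <= n.+1)%N ->
  \sum_(i < n) radius i <=
    2 * B * (Num.sqrt d%:R * Num.sqrt n.+1%:R) * (4 * ln n.+1%:R + 1 / 2)
    + 132 * B ^+ 2 / kappa * (4 * d%:R * ln n.+1%:R).
Proof.
move=> d0 dn.
have B0 : 0 <= B by apply: le_trans (betB (leq0n n)); apply: le_trans (confident (leq0n n)); exact: wnorm_ge0.
have T0 : 0 < n.+1%:R :> R by rewrite ltr0n.
have dR0 : 0 < d%:R :> R by rewrite ltr0n.
have hx : \sum_(i < n) info i <= 4 * d%:R * ln n.+1%:R.
  apply: le_trans (info_sum (leqnn n)) _; have := ln_det_Sigma d0.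
  have : ln (d%:R * n.+1%:R) <= 2 * ln n.+1%:R :> R.
    rewrite lnM ?posrE // mulr_natl mulr2n lerD2r ler_ln ?posrE //.
    by rewrite ler_nat.
  by move=> /(ler_wpM2l (ltW dR0)); lra.
rewrite /radius big_split /= -!mulr_sumr; apply: lerD; last first.
  by rewrite ler_wpM2l // divr_ge0 ?(ltW kappa0) // mulr_ge0 ?sqr_ge0.
rewrite -[leRHS]mulrA ler_wpM2l ?mulr_ge0 //.
set u := Num.sqrt d%:R; set v := Num.sqrt n.+1%:R.
have u0 : 0 < u by rewrite sqrtr_gt0.
have v0 : 0 < v by rewrite sqrtr_gt0.
have u2 : u ^+ 2 = d%:R by rewrite sqr_sqrtr // ltW.
have v2 : v ^+ 2 = n.+1%:R by rewrite sqr_sqrtr // ltW.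
(* AM-GM: [sqrt (2 x) <= x v / u + u / (2 v)] *)
apply: (@le_trans _ _ (\sum_(i < n) (info i * (v / u) + u / (2 * v)))).
  apply: ler_sum => i _; have /andP[i0 _] := info_bounds (ltn_ord i).
  set y := Num.sqrt _; have y2 : y ^+ 2 = 2 * info i by rewrite sqr_sqrtr // mulr_ge0.
  have -> : info i = y ^+ 2 / 2 by rewrite y2; field.
  have -> : y ^+ 2 / 2 * (v / u) + u / (2 * v) = ((y * v - u) ^+ 2 / (2 * u * v)) + y.
    by field; rewrite !gt_eqF.
  by rewrite lerDr divr_ge0 ?sqr_ge0 // !mulr_ge0 // ltW.
rewrite big_split /= -mulr_suml sumr_const card_ord -[X in _ + X <= _]mulr_natl.
have -> : u * v * (4 * ln n.+1%:R + 1 / 2) = 4 * d%:R * ln n.+1%:R * (v / u) + n.+1%:R * (u / (2 * v)).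
  by rewrite -u2 -v2; field; rewrite !gt_eqF.
apply: lerD; first by rewrite ler_wpM2r // divr_ge0 // ltW.
by rewrite ler_wpM2r ?divr_ge0 ?mulr_ge0 ?(ltW u0) ?(ltW v0) // ler_nat.
Qed.

End Nondegenerate.

(** * The case of vanishing features and zero regularisation *)

Section Degenerate.
Hypothesis lambda0 : lambda = 0.
Hypothesis phi0 : forall s a s', phi s a s' = 0.
Hypothesis d0 : (0 < d)%N.

Lemma Sigma_degenerate i : (i <= n)%N -> G i = 0.
Proof.
elim: i => [|i IH] hi; first by rewrite Sigma0 lambda0 raddf0.
rewrite Sigma_next // IH ?(ltnW hi) // /addouter add0r /hvecs big_map big1 // => j _.
by rewrite phi0 /mean big1 ?subr0 ?scaler0 ?mul0mx // => k _; rewrite phi0 scaler0.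
Qed.

(** All determinants are 0, so the doubling test always succeeds and there is a single episode. *)
Lemma same_episode_degenerate i : (i < n)%N -> same (take i w) (nth s1 w i).
Proof.
move=> hi; have det00 : \det (0 : 'M[R]_d) = 0.
  by rewrite -(scale0r 0) detZ expr0n eqn0Ngt d0 mul0r.
rewrite /same_episode -take_nth // episode_detE.
have [j hj ->] := episode_take i.
by rewrite !Sigma_degenerate ?det00 ?mulr0 // (leq_trans hj) // ltnW.
Qed.

Hypothesis bet0 : forall i, (i <= n)%N -> 0 <= bet i.+1.

Lemma pmnl_degenerate th0 s a s' : p th0 s a s' = p ths s a s'.
Proof.
rewrite /pmnl phi0; case: ifP => // _.
have E x : dotv (0 : 'cV[R]_d) x = 0 by rewrite dotv_bil bil0l.
rewrite !E; congr (_ / _); apply: eq_bigr => k _; by rewrite phi0 !E.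
Qed.

Lemma conf_set_degenerate i : (i <= n)%N -> conf (take i w) (p ths).
Proof.
move=> hi; have [j hj ej] := episode_take i.
have jn := leq_trans hj hi.
rewrite /conf_set /= ej time_alg size_takel //; split=> [s a s'|s a].
  by rewrite pmnl_ge0 // pmnl_le1.
split; first exact: pmnl_sum.
rewrite big1 => [|k _]; last by rewrite pmnl_degenerate subrr normr0.
apply: addr_ge0.
  apply: mulr_ge0; first exact: bet0.
  by apply: sumr_ge0 => k _; rewrite mulr_ge0 ?pmnl_ge0 ?wnorm_ge0.
by apply: mulr_ge0; [rewrite mulr_ge0 ?sqr_ge0|exact: bigmax_sqr_ge0].
Qed.

Lemma conf_set_radius_degenerate i q : (i < n)%N -> conf (take i w) q ->
  \sum_(k in Ssa (s_ i) (a_ i)) `|q (s_ i) (a_ i) k - p ths (s_ i) (a_ i) k| <= 0.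
Proof.
move=> hi hq.
have hp := conf_set_degenerate (ltnW hi).
rewrite /conf_set in hp hq.
apply: le_trans (polytope_diameter _ _ hp hq) _.
rewrite /dev [X in _ * X + _]big1 => [|k _]; last first.
  by rewrite phi0 /mean big1 ?subr0 ?wnorm0 ?mulr0 // => l _; rewrite phi0 scaler0.
rewrite (_ : \big[Num.max/0]_(_ in _) _ = 0) ?mulr0 ?addr0 ?mulr0 //.
apply/le_anti; rewrite bigmax_sqr_ge0 andbT; apply: bigmax_le => // k _.
by rewrite phi0 wnorm0 expr0n.
Qed.

End Degenerate.
End Trajectory.

(** * The regret bound *)

Section BivariatePolynomials.
Variable R : realType.

Lemma bipoly_horner n (c : 'I_n -> 'I_n -> R) x y : bipoly c x y =
  (\sum_(i < n) \sum_(j < n) (c i j *: 'X^i)%:P * 'X^j : {poly {poly R}}).[y%:P].[x].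
Proof.
rewrite /bipoly !horner_sum; apply: eq_bigr => i _.
rewrite !horner_sum; apply: eq_bigr => j _.
by rewrite hornerM hornerC hornerXn hornerM hornerZ hornerXn horner_exp hornerC.
Qed.

(** A common bound on the degrees in both variables pads the coefficients to a square array. Closure
    of [bipoly] under ring operations is thereby inherited from polynomials over polynomials. *)
Lemma horner_bipoly (P : {poly {poly R}}) :
  exists n (c : 'I_n -> 'I_n -> R), forall x y, bipoly c x y = P.[y%:P].[x].
Proof.
pose n := maxn (size P) (\max_(j < size P) size (P`_j)%R).
exists n, (fun i j => P`_j`_i) => x y.
rewrite (@horner_coef_wide _ n P) ?leq_maxl // horner_sum /bipoly exchange_big /=.
apply: eq_bigr => j _; rewrite hornerM horner_exp hornerC (@horner_coef_wide _ n).
  by rewrite mulr_suml.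
have [jP|jP] := ltnP j (size P); last by rewrite nth_default ?size_poly0.
by apply: leq_trans (leq_maxr _ _); exact: (leq_bigmax (Ordinal jP)).
Qed.

Lemma bipoly_square n0 (c0 : 'I_n0 -> 'I_n0 -> R) (b : R) :
  exists n (c : 'I_n -> 'I_n -> R), forall x y, bipoly c x y = b * (1 + bipoly c0 x y) ^+ 2.
Proof.
have [n [c h]] := horner_bipoly (b%:P%:P * (1 + \sum_(i < n0) \sum_(j < n0) (c0 i j *: 'X^i)%:P * 'X^j) ^+ 2).
exists n, c => x y; rewrite h bipoly_horner hornerM horner_exp hornerD !hornerC.
by rewrite hornerM horner_exp hornerD !hornerC.
Qed.

End BivariatePolynomials.

(** * Assembling the constants *)

Section FinalArithmetic.
Variable R : realType.

(* Here [D = d], [u = sqrt d], [v = sqrt T], [lt = ln T], [ld = - ln delta], and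
   [f * u * L ^+ 2] is the final confidence radius. *)
Lemma regret_arithmetic (g V reg D u v f L lt ld kap sumR sumN M K : R) :
  0 <= g < 1 -> V = (1 - g)^-1 -> 1 <= D -> 0 <= u -> u ^+ 2 = D -> 1 <= v -> 0 <= f ->
  0 <= lt <= L -> ld <= L -> 0 < kap ->
  (1 - g) * reg <= V + g * sumR * V + sumN + g * M + g * (V * K) ->
  sumR <= 2 * (f * u * L ^+ 2) * (u * v) * (4 * lt + 1 / 2) +
          132 * (f * u * L ^+ 2) ^+ 2 / kap * (4 * D * lt) ->
  sumN <= D * v -> M <= 2 * V * v * (1 + ld) -> 0 <= K <= 4 * D * lt -> 
  reg <= 528 * (1 + f) ^+ 2 * (1 + L) ^+ 5 * (D * V ^+ 2 * v + kap^-1 * D ^+ 2 * V ^+ 2).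
Proof.
move=> /andP[g0 g1] VE D1 u0 uD v1 f0 /andP[lt0 ltL] ldL k0 hreg hR hN hM /andP[K0 hK].
have L0 : 0 <= L by apply: le_trans ltL.
have g1' : 0 < 1 - g by rewrite subr_gt0.
have V1 : 1 <= V by rewrite VE invf_ge1 // lerBlDr lerDl.
have V0 : 0 <= V by apply: le_trans V1.
set l := 1 + L; have l1 : 1 <= l by rewrite lerDl.
have l0 : 0 <= l by apply: le_trans l1.
have Dv1 : 1 <= D * v by rewrite -[leLHS]mulr1; apply: ler_pM.
have Dv0 : 0 <= D * v by apply: le_trans Dv1.
have ik0 : 0 <= kap^-1 by rewrite invr_ge0 ltW.
have D0 : 0 <= D by apply: le_trans D1.
have v0 : 0 <= v by apply: le_trans v1.
set W := D * v in Dv1 Dv0 hN *.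
set X := kap^-1 * D ^+ 2; have X0 : 0 <= X by rewrite mulr_ge0 ?sqr_ge0.
have hl k : (k <= 5)%N -> l ^+ k <= l ^+ 5 by move=> hk; exact: (ler_weXn2l l1 hk).
have Ll : L <= l by rewrite lerDr.
have fX0 : 0 <= 528 * f ^+ 2 * X := mulr_ge0 (mulr_ge0 (ler0n _ 528) (sqr_ge0 f)) X0.
have fW0 : 0 <= 8 * f * W by rewrite !mulr_ge0.
(* Here 8 comes from [2 * (4 * lt + 1/2) <= 8 * l] and 528 is [132 * 4]. The power 5 is four
   logarithms from the squared radius and one from the information sum. *)
have sumRle : sumR <= l ^+ 5 * (8 * f * W + 528 * f ^+ 2 * X).
  apply: le_trans hR _.
  have -> : l ^+ 5 * (8 * f * W + 528 * f ^+ 2 * X) = 8 * f * W * l ^+ 5 + 528 * f ^+ 2 * X * l ^+ 5 by ring.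
  apply: lerD.
    have -> : 2 * (f * u * L ^+ 2) * (u * v) * (4 * lt + 1 / 2) =
      2 * f * W * (L ^+ 2 * (4 * lt + 1 / 2)) by rewrite /W -uD; field.
    have -> : 8 * f * W * l ^+ 5 = 2 * f * W * (4 * l ^+ 5) by ring.
    rewrite ler_wpM2l ?mulr_ge0 //.
    apply: (@le_trans _ _ (l ^+ 2 * (4 * l))); last first.
      have -> : l ^+ 2 * (4 * l) = 4 * l ^+ 3 by ring.
      by have := hl 3%N isT; lra.
    apply: ler_pM; [exact: sqr_ge0|lra|by rewrite lerXn2r ?nnegrE|rewrite /l; lra].
  have -> : 132 * (f * u * L ^+ 2) ^+ 2 / kap * (4 * D * lt) = 528 * f ^+ 2 * X * (L ^+ 4 * lt).
    by rewrite /X -uD; field; rewrite gt_eqF.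
  rewrite ler_wpM2l // [l ^+ 5]exprSr.
  by apply: ler_pM => //; [exact: exprn_ge0|rewrite lerXn2r ?nnegrE|exact: le_trans ltL Ll].
have l5 : 1 <= l ^+ 5 by have := hl 0%N isT; rewrite expr0.
have ll5 : l <= l ^+ 5 by have := hl 1%N isT; rewrite expr1.
have vW : v <= W by rewrite /W ler_peMl // (le_trans _ v1).
have DW : D <= W by rewrite /W ler_peMr // (le_trans _ D1).
(* The extra 8 is [1 + 1 + 2 + 4], for [V], the truncation error, the martingale and the
   episodes. *)
pose Y := l ^+ 5 * (8 * (1 + f) * W + 528 * f ^+ 2 * X).
have Rhs : V + g * sumR * V + sumN + g * M + g * (V * K) <= V * Y.
  have S0 : 0 <= l ^+ 5 * (8 * f * W + 528 * f ^+ 2 * X).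
    exact: mulr_ge0 (exprn_ge0 _ l0) (addr_ge0 fW0 fX0).
  have h1 : g * sumR * V <= V * (l ^+ 5 * (8 * f * W + 528 * f ^+ 2 * X)).
    rewrite mulrC ler_wpM2l // (le_trans (ler_wpM2l g0 sumRle)) // ler_piMl // ltW //.
  have Wl : W <= W * l ^+ 5 by rewrite ler_peMr.
  have h2 : V <= V * (W * l ^+ 5) by rewrite ler_peMr // (le_trans Dv1).
  have h3 : sumN <= V * (W * l ^+ 5).
    by apply: le_trans hN _; apply: le_trans Wl _; rewrite ler_peMl // mulr_ge0 ?exprn_ge0.
  have h4 : g * M <= V * (2 * (W * l ^+ 5)).
    apply: (@le_trans _ _ (g * (V * (2 * (W * l ^+ 5))))); last first.
      by rewrite ler_piMl ?(ltW g1) // !mulr_ge0 ?exprn_ge0.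
    rewrite ler_wpM2l //; apply: le_trans hM _.
    have -> : 2 * V * v * (1 + ld) = V * (2 * (v * (1 + ld))) by ring.
    rewrite ler_wpM2l // ler_wpM2l //.
    apply: (@le_trans _ _ (v * l)); first by rewrite ler_wpM2l ?(le_trans _ v1) // /l lerD2l.
    by apply: ler_pM => //; exact: le_trans v1.
  have h5 : g * (V * K) <= V * (4 * (W * l ^+ 5)).
    apply: (@le_trans _ _ (V * K)); first by rewrite ler_piMl ?(ltW g1) // mulr_ge0.
    rewrite ler_wpM2l //; apply: le_trans hK _; rewrite -mulrA ler_wpM2l //.
    by apply: ler_pM => //; exact: le_trans ltL (le_trans Ll ll5).
  rewrite /Y; have -> : V * (l ^+ 5 * (8 * (1 + f) * W + 528 * f ^+ 2 * X)) =
    V * (l ^+ 5 * (8 * f * W + 528 * f ^+ 2 * X)) + 8 * (V * (W * l ^+ 5)) by ring.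
  lra.
have : reg <= V * (V * Y).
  rewrite {1}VE mulrC ler_pdivlMr // mulrC; exact: le_trans Rhs.
move=> /le_trans; apply.
have -> : 528 * (1 + f) ^+ 2 * l ^+ 5 * (D * V ^+ 2 * v + X * V ^+ 2) =
  V * (V * (l ^+ 5 * (528 * (1 + f) ^+ 2 * (W + X)))) by rewrite /W; ring.
rewrite /Y !ler_wpM2l ?exprn_ge0 // [leRHS]mulrDr; apply: lerD.
  rewrite ler_wpM2r // (_ : 528 * (1 + f) ^+ 2 = 8 * (1 + f) + (520 + 1048 * f + 528 * f ^+ 2)); last by ring.
  by rewrite lerDl; exact: addr_ge0 (addr_ge0 (ler0n _ 520) (mulr_ge0 (ler0n _ 1048) f0)) (mulr_ge0 (ler0n _ 528) (sqr_ge0 f)).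
rewrite ler_wpM2r // (_ : 528 * (1 + f) ^+ 2 = 528 * f ^+ 2 + 528 * (1 + 2 * f)); last by ring.
by rewrite lerDl; exact: mulr_ge0 (ler0n _ 528) (addr_ge0 ler01 (mulr_ge0 (ler0n _ 2) f0)).
Qed.

(** Since [g <= expR (g - 1)], the condition on [N] gives [g ^+ N <= D / v]; over [v ^+ 2] rounds
    the truncation then costs [D * v]. *)
Lemma discount_pow_le (g D v : R) N : 0 <= g < 1 -> 0 < D -> 0 < v ->
  ln (v / D) / (1 - g) <= N%:R -> g ^+ N * v ^+ 2 <= D * v.
Proof.
move=> /andP[g0 g1] D0 v0 hN.
have h1 : ln (v / D) <= N%:R * (1 - g) by rewrite -ler_pdivrMr // subr_gt0.
have h2 : g ^+ N <= expR (- ln (v / D)).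
  apply: (@le_trans _ _ (expR (g - 1) ^+ N)).
    rewrite lerXn2r ?nnegrE ?expR_ge0 //; have := expR_ge1Dx (g - 1); lra.
  rewrite -expRM_natl ler_expR; lra.
rewrite expRN lnK ?posrE ?divr_gt0 // invf_div in h2.
have := ler_wpM2r (sqr_ge0 v) h2; have -> // : D / v * v ^+ 2 = D * v.
by field; rewrite gt_eqF.
Qed.

Lemma dotv_eq0 d (x : 'cV[R]_d) : dotv x x <= 0 -> x = 0.
Proof.
have -> : dotv x x = \sum_i x i 0 ^+ 2.
  by rewrite /dotv mxE; apply: eq_bigr => i _; rewrite mxE expr2.
move=> h; apply/colP => i; rewrite mxE; apply/eqP; rewrite -sqrf_eq0.
apply/eqP/le_anti; rewrite sqr_ge0 andbT; apply: le_trans h.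
by rewrite (bigD1 i) //= lerDl; apply: sumr_ge0 => j _; exact: sqr_ge0.
Qed.

End FinalArithmetic.

Lemma regret_le_horizon (R : realType) (S A : finType) (d : nat)
  (Ssa : S -> A -> {set S}) (phi : S -> A -> S -> 'cV[R]_d)
  (r : S -> A -> R) (gamma : R) (ths : 'cV[R]_d) (a0 : A) (pol : hpolicy S A) T s1 w :
  (forall s a, exists s', s' \in Ssa s a) -> 0 <= gamma < 1 ->
  (forall s a, 0 <= r s a <= 1) ->
  regret Ssa phi r gamma ths pol T s1 w <= T%:R * (1 - gamma)^-1.
Proof.
move=> Ssa0 g01 r01; rewrite /regret.
apply: (@le_trans _ _ (\sum_(i < T) (1 - gamma)^-1)); last first.
  by rewrite sumr_const card_ord mulr_natl.
apply: ler_sum => i _; rewrite lerBlDr -[leLHS]addr0; apply: lerD; last exact: Vpi_ge0.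
apply: ge_sup.
  by exists (Vpi Ssa phi r gamma ths (fun _ _ => a0) (last s1 (take i w)) [::]); exists (fun _ _ => a0).
by move=> _ [pl ->]; exact: Vpi_le.
Qed.

Theorem theorem4 (R : realType) (n0 : nat) (c0 : 'I_n0 -> 'I_n0 -> R) :
  exists (n : nat) (c : 'I_n -> 'I_n -> R) (k : nat),
  forall (S A : finType) (d : nat) (Ssa : S -> A -> {set S})
    (phi : S -> A -> S -> 'cV[R]_d) (r : S -> A -> R)
    (gamma delta kappa Ltheta Lphi lambda eta : R) (N T : nat)
    (theta_star : 'cV[R]_d) (argsel : (A -> R) -> A) (a0 : A) (s1 : S),
  let f0 := bipoly c0 in
  let U := Ucal Ssa in
  let pol : hpolicy S A := fun s rest =>
    ucmnlk Ssa phi r gamma lambda eta delta Ltheta Lphi N f0 argsel a0 s rest in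
  (* parameters *)
  0 <= gamma < 1 -> 0 < delta < 1 -> 0 < kappa < 1 -> (0 < d)%N -> (0 < T)%N ->
  (forall s a, 0 <= r s a <= 1) ->
  (* argsel picks a maximiser (arbitrary tie-breaking) *)
  (forall (f : A -> R) (a : A), f a <= f (argsel f)) ->
  (* (A1) *)
  (forall s a s', norm2 (phi s a s') <= Lphi) -> norm2 theta_star <= Ltheta ->
  (* (A2), for the visited pairs (s_t, a_t), t in [T], on every feasible trajectory *)
  (forall rest : seq S, (size rest < T)%N -> feasible Ssa pol s1 rest ->
     let s := last s1 rest in let a := pol s1 rest in
     forall th, Theta Ltheta th -> forall s' s'', s' \in Ssa s a -> s'' \in Ssa s a ->
       kappa <= pmnl Ssa phi th s a s' * pmnl Ssa phi th s a s'') ->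
  (* (A3) *)
  (forall s a, exists2 s', s' \in Ssa s a & phi s a s' = 0) ->
  (* algorithm parameters *)
  eta = 2^-1 * ln U%:R + (Ltheta * Lphi + 1) ->
  84 * Num.sqrt 2 * (Ltheta * Lphi ^+ 3 + d%:R * Lphi ^+ 2) * eta <= lambda ->
  ln (Num.sqrt T%:R / d%:R) / (1 - gamma) <= N%:R ->
  (* confidence bound of the estimator holds w.p. >= 1 - delta (defining property of f0) *)
  1 - delta <= prob Ssa phi theta_star pol T.-1 s1 [::] (fun rest =>
     forall i : nat, (i < T)%N ->
       let st := alg_state Ssa phi r gamma lambda eta delta Ltheta Lphi N f0 argsel a0
                   s1 (take i rest) in
       wnorm (Sigma st) (th_hat st - theta_star) <= beta d Ssa delta Ltheta Lphi f0 i.+1) ->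
  (* conclusion: regret bound w.p. >= 1 - 2 delta *)
  1 - 2 * delta <= prob Ssa phi theta_star pol T.-1 s1 [::] (fun rest =>
     regret Ssa phi r gamma theta_star pol T s1 rest <=
       bipoly c Ltheta Lphi * (1 + ln ((U * T)%:R / delta)) ^+ k *
       (d%:R * (1 - gamma)^-2 * Num.sqrt T%:R
        + kappa^-1 * d%:R ^+ 2 * (1 - gamma)^-2)).
Proof.
have [n [c hc]] := bipoly_square c0 528.
exists n, c, 5%N.
move=> S A d Ssa phi r gamma delta kappa Ltheta Lphi lambda eta N T theta_star argsel a0 s1 f0 U pol.
move=> g01 d01 k01 d0 T0 r01 argselP phiL thL A2 A3 etaE lamE hN hE1.
have Ssa0 s a : exists s', s' \in Ssa s a by have [s' hs' _] := A3 s a; exists s'.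
have dl0 : 0 < delta by case/andP: d01.
have dl1 : delta < 1 by case/andP: d01.
have k0 : 0 < kappa by case/andP: k01.
have g1 : gamma < 1 by case/andP: g01.
have Lth0 : 0 <= Ltheta by apply: le_trans thL; exact: sqrtr_ge0.
have Lph0 : 0 <= Lphi by apply: le_trans (phiL s1 a0 s1); exact: sqrtr_ge0.
have U1 : (1 <= U)%N.
  apply: (@leq_trans #|Ssa s1 a0|); last exact: (leq_bigmax (s1, a0)).
  by have [s' hs'] := Ssa0 s1 a0; apply/card_gt0P; exists s'.
have dR : 1 <= d%:R :> R by rewrite ler1n.
have dR0 : 0 < d%:R :> R by rewrite ltr0n.
have TR0 : 0 < T%:R :> R by rewrite ltr0n.
have hln m : (0 < m)%N -> 0 < ln ((U * m)%:R / delta).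
  move=> m0; apply: ln_gt0; rewrite ltr_pdivlMr // mul1r; apply: lt_le_trans dl1 _.
  by rewrite ler1n muln_gt0 U1.
set L := ln ((U * T)%:R / delta).
have V0 := Vmax_gt0 g01; have V1 := Vmax_ge1 g01.
have X0 : 0 < 2 * (1 - gamma)^-1 by rewrite mulr_gt0.
apply: (azuma_union Ssa0 X0 (noise_mean phi r gamma lambda eta delta Ltheta Lphi N f0 argsel a0 s1 theta_star Ssa0)
  (noise_norm phi lambda eta delta Ltheta Lphi N f0 argsel a0 s1 theta_star Ssa0 g01 r01) (leq_pred T) T0 dl0 hE1).
move=> w sw wf hconf hmart.
have swT : (size w).+1 = T by rewrite sw prednK.
(* On the confidence event [beta] dominates a norm; this yields its sign, and with positive
   logarithms also the sign of [f0 Ltheta Lphi]. *)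
have bet0 i : (i <= size w)%N -> 0 <= beta d Ssa delta Ltheta Lphi f0 i.+1.
  by move=> hi; apply: le_trans (hconf i _); [exact: wnorm_ge0|rewrite -swT ltnS].
have f00 : 0 <= f0 Ltheta Lphi.
  have := bet0 0%N isT; rewrite /beta -mulrA pmulr_lge0 // mulr_gt0 ?sqrtr_gt0 //.
  by rewrite exprn_gt0 // hln.
set v := Num.sqrt T%:R; pose u := Num.sqrt d%:R : R.
have v0 : 0 < v by rewrite sqrtr_gt0.
have v1 : 1 <= v by rewrite -[leLHS]sqrtr1 ler_wsqrtr // ler1n.
have u0 : 0 <= u by exact: sqrtr_ge0.
have v2 : v ^+ 2 = T%:R by rewrite sqr_sqrtr // ltW.
have u2 : u ^+ 2 = d%:R by rewrite sqr_sqrtr // ltW.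
have lnT : ln T%:R <= L.
  rewrite ler_ln ?posrE ?divr_gt0 ?ltr0n ?muln_gt0 ?U1 //.
  rewrite ler_pdivlMr //; apply: (@le_trans _ _ T%:R); first by rewrite ler_piMr ?ltW.
  by rewrite ler_nat leq_pmull.
have lnT0 : 0 <= ln T%:R :> R by apply: ln_ge0; rewrite ler1n.
have lnd : - ln delta <= L.
  rewrite -lnV ?posrE // ler_ln ?posrE ?invr_gt0 ?divr_gt0 ?ltr0n ?muln_gt0 ?U1 //.
  by rewrite ler_peMl ?invr_ge0 ?(ltW dl0) // ler1n muln_gt0 U1.
have L0 : 0 <= L by apply: le_trans lnT.
have iV2 : (1 - gamma) ^- 2 = (1 - gamma)^-1 ^+ 2 by rewrite exprVn.
rewrite hc -/f0 -/L iV2.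
have sN0 : \sum_(i < size w) gamma ^+ N <= d%:R * v.
  apply: le_trans (discount_pow_le g01 dR0 v0 hN); rewrite sumr_const card_ord v2 -[leLHS]mulr_natr.
  rewrite ler_wpM2l ?exprn_ge0 //; first by case/andP: g01.
  by rewrite ler_nat -swT.
pose conf i := conf_set Ssa phi r gamma lambda eta delta Ltheta Lphi N f0 argsel a0 s1 (take i w).
pose same i := same_episode Ssa phi r gamma lambda eta delta Ltheta Lphi N f0 argsel a0 s1 (take i w) (nth s1 w i).
(* The final estimate for an abstract radius bound [rho], shared by the singular and the regular
   case. *)
have bound (rho : nat -> R) : (0 < N)%N ->
  (forall i, (i <= size w)%N -> conf i (pmnl Ssa phi theta_star)) ->
  (forall i q, (i < size w)%N -> conf i q ->
     \sum_(x in Ssa (last s1 (take i w)) (pol s1 (take i w)))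
      `|q (last s1 (take i w)) (pol s1 (take i w)) x -
        pmnl Ssa phi theta_star (last s1 (take i w)) (pol s1 (take i w)) x| <= rho i) ->
  \sum_(i < size w) rho i <=
    2 * (f0 Ltheta Lphi * u * L ^+ 2) * (u * v) * (4 * ln T%:R + 1 / 2) +
    132 * (f0 Ltheta Lphi * u * L ^+ 2) ^+ 2 / kappa * (4 * d%:R * ln T%:R) ->
  \sum_(i < size w) (~~ same i)%:R <= 4 * d%:R * ln T%:R :> R ->
  regret Ssa phi r gamma theta_star pol T s1 w <=
  528 * (1 + f0 Ltheta Lphi) ^+ 2 * (1 + L) ^+ 5 *
  (d%:R * (1 - gamma)^-1 ^+ 2 * v + kappa^-1 * d%:R ^+ 2 * (1 - gamma)^-1 ^+ 2).
  move=> N0 h1 h2 h3 h4.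
  have h1' i : (i < T)%N -> conf i (pmnl Ssa phi theta_star) by rewrite -swT ltnS; exact: h1.
  have := regret_decomposition Ssa0 g01 r01 argselP N0 swT h1' h2.
  rewrite big_split /= -mulr_suml -mulr_sumr addrA => hdec.
  apply: (regret_arithmetic g01 erefl dR u0 u2 v1 f00 _ lnd k0 hdec h3 sN0 hmart).
    by rewrite lnT0.
  by apply/andP; split; [apply: sumr_ge0 => i _; exact: ler0n|exact: h4].
have lam1 : 4 * Lphi ^+ 2 <= lambda.
  apply: le_trans lamE; have eta1 : 1 <= eta.
    rewrite etaE; have : 0 <= ln U%:R :> R by apply: ln_ge0; rewrite ler1n.
    by have : 0 <= Ltheta * Lphi by [exact: mulr_ge0]; lra.
  have s2 : 1 <= Num.sqrt 2 :> R by rewrite -[leLHS]sqrtr1 ler_wsqrtr // ler1n.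
  have h3 : Lphi ^+ 2 <= Ltheta * Lphi ^+ 3 + d%:R * Lphi ^+ 2.
    apply: (@le_trans _ _ (d%:R * Lphi ^+ 2)); first by rewrite ler_peMl ?sqr_ge0.
    by rewrite lerDr mulr_ge0 ?exprn_ge0.
  have h0 := sqr_ge0 Lphi.
  apply: (@le_trans _ _ (84 * 1 * Lphi ^+ 2 * 1)); first by lra.
  have h84 : 0 <= 84 * 1 :> R by rewrite mulr1.
  apply: ler_pM; [exact: mulr_ge0|exact: ler01| |exact: eta1].
  apply: ler_pM; [exact: h84|exact: h0| |exact: h3].
  by rewrite ler_wpM2l.
have [dv|dv] := leP v d%:R.
  have hreg := regret_le_horizon phi theta_star a0 pol T s1 w Ssa0 g01 r01.
  apply: le_trans hreg _.
  have hd : T%:R * (1 - gamma)^-1 <= d%:R * (1 - gamma)^-1 ^+ 2 * v.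
    have -> : T%:R * (1 - gamma)^-1 = v * (1 - gamma)^-1 * v by rewrite -v2; ring.
    rewrite ler_wpM2r ?(ltW v0) // expr2; apply: ler_pM => //; [exact: ltW|exact: ltW|].
    by rewrite ler_peMl // ltW.
  have hk : 0 <= kappa^-1 * d%:R ^+ 2 * (1 - gamma)^-1 ^+ 2.
    apply: mulr_ge0; last exact: sqr_ge0.
    by apply: mulr_ge0; [rewrite invr_ge0 ltW|exact: sqr_ge0].
  have hd0 : 0 <= d%:R * (1 - gamma)^-1 ^+ 2 * v.
    by apply: mulr_ge0; [apply: mulr_ge0; [exact: ltW|exact: sqr_ge0]|exact: ltW].
  apply: (le_trans hd); set X := (X in _ <= _ * X).
  apply: (@le_trans _ _ X).
    by rewrite /X lerDl.
  have X0' : 0 <= X by exact: addr_ge0.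
  have h1 : 1 <= (1 + f0 Ltheta Lphi) ^+ 2 by rewrite exprn_ege1 // lerDl.
  have h2 : 1 <= (1 + L) ^+ 5 by rewrite exprn_ege1 // lerDl.
  rewrite ler_peMl // -[leLHS]mulr1; apply: ler_pM => //.
  by apply: le_trans h1 _; rewrite ler_peMl ?sqr_ge0 // ler1n.
(* Now [d < sqrt T], so the logarithm in the condition on [N] is positive. *)
have N0 : (0 < N)%N.
  rewrite lt0n; apply: contraTneq hN => ->; rewrite -ltNge divr_gt0 ?subr_gt0 //.
  by apply: ln_gt0; rewrite ltr_pdivlMr // mul1r.
have dT : (d <= T)%N.
  rewrite -(ler_nat R) -v2; apply: le_trans (ltW dv) _; by rewrite expr2 ler_peMl // ltW.
(* From [4 * Lphi ^+ 2 <= lambda], a nonpositive [lambda] forces [lambda = 0] and all features to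
   vanish. *)
have [lam0|lam0] := ltP 0 lambda; last first.
  have Lp2 : Lphi ^+ 2 = 0 by apply/le_anti; rewrite sqr_ge0 andbT; lra.
  have lamz : lambda = 0 by apply/le_anti; rewrite lam0 /=; move: lam1; rewrite Lp2 mulr0.
  have phi0 s a s' : phi s a s' = 0.
    apply: dotv_eq0; have := phiL s a s'; rewrite /norm2 => h.
    rewrite -(sqr_sqrtr (dotv_ge0 (phi s a s'))) -Lp2.
    by rewrite lerXn2r ?nnegrE ?sqrtr_ge0.
  have B0 : 0 <= f0 Ltheta Lphi * u * L ^+ 2 by rewrite !mulr_ge0 ?exprn_ge0.
  apply: (bound (fun _ => 0 : R) N0).
  - by move=> i hi; exact: (conf_set_degenerate r gamma lambda eta N argsel a0 s1 theta_star Ssa0 phi0 bet0).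
  - by move=> i q hi hq; exact: (conf_set_radius_degenerate theta_star Ssa0 phi0 bet0 hi hq).
  - rewrite big1 //; apply: addr_ge0.
      apply: mulr_ge0; last by rewrite addr_ge0 // mulr_ge0.
      by apply: mulr_ge0; [exact: mulr_ge0|exact: mulr_ge0 u0 (ltW v0)].
    apply: mulr_ge0; last by rewrite !mulr_ge0 // ltW.
    apply: mulr_ge0; last by rewrite invr_ge0 ltW.
    by apply: mulr_ge0; [exact: ler0n|exact: sqr_ge0].
  - rewrite big1; first by rewrite !mulr_ge0 // ltW.
    move=> i _; by rewrite /same (same_episode_degenerate Ssa0 wf lamz phi0 d0).
pose B := f0 Ltheta Lphi * u * L ^+ 2.
have hB i : (i <= size w)%N -> beta d Ssa delta Ltheta Lphi f0 i.+1 <= B.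
  move=> hi; rewrite /beta /B -/u ler_wpM2l ?mulr_ge0 // lerXn2r ?nnegrE ?(ltW (hln _ _)) //.
  rewrite ler_ln ?posrE ?divr_gt0 ?ltr0n ?muln_gt0 ?U1 // ler_pM2r ?invr_gt0 //.
  by rewrite ler_nat leq_mul2l -swT ltnS hi orbT.
have hconf' i : (i <= size w)%N -> wnorm
    (Sigma (alg_state Ssa phi r gamma lambda eta delta Ltheta Lphi N f0 argsel a0 s1 (take i w)))
    (th_hat (alg_state Ssa phi r gamma lambda eta delta Ltheta Lphi N f0 argsel a0 s1 (take i w)) - theta_star)
    <= beta d Ssa delta Ltheta Lphi f0 i.+1.
  by move=> hi; apply: hconf; rewrite -swT ltnS.
have A2' i : (i < size w)%N -> forall th0, Theta Ltheta th0 ->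
  forall s' s'', s' \in Ssa (last s1 (take i w)) (pol s1 (take i w)) ->
  s'' \in Ssa (last s1 (take i w)) (pol s1 (take i w)) ->
  kappa <= pmnl Ssa phi th0 (last s1 (take i w)) (pol s1 (take i w)) s' *
           pmnl Ssa phi th0 (last s1 (take i w)) (pol s1 (take i w)) s''.
  move=> hi th0 hth s' s'' h1 h2.
  have hs : (size (take i w) < T)%N by rewrite size_takel -?swT ?ltnS ltnW.
  exact: (A2 (take i w) hs (feasible_take i wf) th0 hth s' s'' h1 h2).
apply: (bound (radius Ssa phi r gamma lambda eta delta Ltheta Lphi N f0 argsel a0 s1 w kappa B) N0).
- by move=> i hi; exact: (conf_set_star Ssa0 wf lam0 hconf').
- by move=> i q hi hq; exact: (conf_set_radius Ssa0 Lth0 wf lam0 lam1 phiL k0 A2' A3 hconf' hB hi hq).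
- have := radius_sum Ssa0 wf lam0 lam1 phiL k0 hconf' hB d0; rewrite swT; exact.
apply: le_trans (episode_count_le Ssa0 wf lam0 lam1 phiL d0) _; rewrite swT.
rewrite lnM ?posrE //; have hd : ln d%:R <= ln T%:R :> R by rewrite ler_ln ?posrE // ler_nat.
by have := ler_wpM2l (ltW dR0) hd; lra.
Qed.
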